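(* Let $\pi\colon H\to G$ be a smallest embedding cover of a profinite group $G$, and let $$\cdots\xrightarrow{\pi_3}G_2\xrightarrow{\pi_2}G_1\xrightarrow{\pi_1}G_0=G$$ be the fundament series of $\pi$. Let $k\ge 1$ and let $\rho_{k-1}\colon H\to G_{k-1}$ be the projection. Let $\tau\colon H'\to G_{k-1}$ be a fundamental epimorphism with finite kernel. The following are equivalent: (a) $\tau$ is basic (i.e. a basic cover of $G_{k-1}$); (b) $\tau$ is an I-cover of $G_{k-1}$; (c) $\rho_{k-1}$ dominates $\tau$; (d) $\pi_k$ dominates $\tau$.
   Context: All groups are profinite, homomorphisms are continuous, an epimorphism is a surjective homomorphism. A cover of $G$ is an epimorphism $\eta\colon H\to G$. It dominates a cover $\pi\colon E\to G$ if $\eta=\pi\circ\psi$ for some epimorphism $\psi\colon H\to E$. $E$ has the embedding property if for every epimorphism $\alpha\colon B\to A$ of finite quotients of $E$ and every epimorphism $\varphi\colon E\to A$ there is an epimorphism $\gamma\colon E\to B$ with $\alpha\circ\gamma=\varphi$. An embedding cover of $G$ is an epimorphism $E\to G$ with $E$ having the embedding property. An I-cover of $G$ is an epimorphism onto $G$ dominated by every embedding cover of $G$. A smallest embedding cover of $G$ is an embedding cover of $G$ which is an I-cover of $G$; it is known to exist, and if $E\to G$, $E'\to G$ are two such, then $E,E'$ are quotients of each other. $\mathcal{E}_f(G)$ denotes the set of isomorphism types of finite quotients of a smallest embedding cover $E$ of $G$ (independent of the choice). A commutative square of epimorphisms $\beta\colon H\to B$, $\eta\colon H\to G$, $\alpha\colon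 B\to A$, $\varphi\colon G\to A$ ($\alpha\circ\beta=\varphi\circ\eta$) is cartesian if $(\beta,\eta)$ maps $H$ isomorphically onto the fiber product $B\times_A G$. A cartesian square is compact if no proper closed subgroup of $H$ is mapped both onto $B$ by $\beta$ and onto $G$ by $\eta$. A cover $\eta\colon H\to G$ is a basic cover of $G$ if there are epimorphisms $\beta\colon H\to B$, $\alpha\colon B\to A$, $\varphi\colon G\to A$ with $\alpha\circ\beta=\varphi\circ\eta$ and $B\in\mathcal{E}_f(G)$ such that the square formed by $\beta,\eta,\alpha,\varphi$ is cartesian and compact. An epimorphism $\eta$ is indecomposable if it is not an isomorphism and whenever $\eta=\eta_2\circ\eta_1$ with epimorphisms $\eta_1,\eta_2$, one of them is an isomorphism. For an epimorphism $\pi\colon H\to G$, $\mathcal{M}(\pi)$ is the intersection of all closed $N\triangleleft H$ with $N\le\operatorname{Ker}\pi$ such that the induced map $H/N\to G$ is indecomposable (the intersection is $\operatorname{Ker}\pi$ if there are none). The fundament of $\pi$ is the induced map $H/\mathcal{M}(\pi)\to G$ (up to isomorphism). $\pi$ is fundamental if $\mathcal{M}(\pi)=1$. The fundament series of $\pi\colon H\to G$: $G_0=G$, $\rho_0=\pi$, and inductively for $k\ge1$, $\pi_k\colon G_k\to G_{k-1}$ is the fundament of $\rho_{k-1}\colon H\to G_{k-1}$, with quotient map (projection) $\rho_k\colon H\to G_k$ satisfying $\pi_k\circ\rho_k=\rho_{k-1}$, $\operatorname{Ker}\rho_k=\mathcal{M}(\rho_{k-1})$. *)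

(* Defs.v *)
From HB Require Import structures.
From mathcomp Require Import all_boot.
From mathcomp Require Import all_classical.
From mathcomp Require Import topology.

Set Implicit Arguments.
Unset Strict Implicit.
Unset Printing Implicit Defensive.

Local Open Scope classical_set_scope.
Local Open Scope group_scope.
Local Open Scope quotient_scope.

HB.structure Definition PreTopologicalGroup :=
  {G of Topological G & Group G}.

HB.mixin Record PreTopologicalGroup_isTopologicalGroup G
    of PreTopologicalGroup G := {
  mulg_continuous : continuous (fun x : G * G => x.1 * x.2);
  invg_continuous : continuous (fun x : G => x^-1)
}.

#[short(type="topologicalGroupType")]
HB.structure Definition TopologicalGroup :=
  {G of PreTopologicalGroup G & PreTopologicalGroup_isTopologicalGroup G}.

HB.mixin Record TopologicalGroup_isProfinite G of TopologicalGroup G := {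
  profinite_compact : compact [set: G];
  profinite_hausdorff : hausdorff_space G;
  profinite_totally_disconnected : totally_disconnected [set: G]
}.

#[short(type="profiniteGroupType")]
HB.structure Definition ProfiniteGroup :=
  {G of TopologicalGroup G & TopologicalGroup_isProfinite G}.

Definition is_subgroup (G : groupType) (K : set G) :=
  K 1 /\ forall x y, K x -> K y -> K (x / y).

Definition is_normal (G : groupType) (K : set G) := forall x y, K x -> K (x ^ y).

Record closedNormal (G : topologicalGroupType) := ClosedNormal {
  closedNormal_set :> set G;
  closedNormal_closed : closed closedNormal_set;
  closedNormal_subgroup : is_subgroup closedNormal_set;
  closedNormal_normal : is_normal closedNormal_set
}.

Lemma zero_dimensional_hausdorff (T : topologicalType) :
  zero_dimensional T -> hausdorff_space T.
Proof.
move=> zT; rewrite open_hausdorff => x y /zT[U [[oU cU] Ux Uy]].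
exists (U, ~` U) => /=; first by rewrite !inE.
by split; [exact: oU|exact: closed_openC|apply/eqP; exact: setICr].
Qed.

Lemma compact_totally_disconnected (T : topologicalType) :
  compact [set: T] -> hausdorff_space T -> totally_disconnected [set: T] ->
  zero_dimensional T.
Proof.
move=> cT hT tdT x y /eqP xy; apply: contrapT => nU.
pose Q := [set z : T | forall U, clopen U -> U x -> U z].
have Qx : Q x by [].
have Qy : Q y.
  by move=> U cU Ux; apply: contrapT => Uy; apply: nU; exists U.
have clQ : closed Q.
  have -> : Q = \bigcap_(U in [set U | clopen U /\ U x]) U.
    by apply/seteqP; split=> z Qz U; [case=> cU Ux; exact: Qz|move=> *; exact: Qz].
  by apply: closed_bigI => U [[]].
have sepQ P R z : closed P -> closed R -> P `&` R = set0 -> Q `<=` P `|` R ->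
    P x -> Q z -> R z -> False.
  move=> cP cR PR0 QPR Px Qz Rz.
  have PR : set_nbhs P (~` R).
    by apply/set_nbhsP; exists (~` R); split=> //;
      [exact: closed_openC|exact/disjoints_subset].
  have [U /set_nbhsP[V [oV PV VU]] UR] := compact_normal hT cT cP PR.
  have VR : closure V `<=` ~` R by apply: subset_trans UR; exact: closureS.
  pose W := closure V `&` ~` V.
  have cW : compact W.
    apply: (subclosed_compact _ cT) => //; apply: closedI.
      exact: closed_closure.
    exact: open_closedC.
  pose F := filter_from [set D : set T | D x /\ clopen D] id.
  have FF : Filter F.
    apply: filter_from_filter; first by exists setT; split => //; exact: clopenT.
    by move=> A B [? ?] [? ?]; exists (A `&` B) => //; split=> //; exact: clopenI.
  have PF : ProperFilter F by apply: filter_from_proper; move=> ? [? _]; exists x.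
  move/compact_near_coveringP : cW.
  move=> /(_ _ _ setC (powerset_filter_from_filter PF))[].
    move=> w [Vw nVw].
    have nQw : ~ Q w by move=> /QPR[/PV//|]; exact: VR.
    have [K [[oK cK] Kx Kw]] : exists K, [/\ clopen K, K x & ~ K w].
      by apply: contrapT => nK; apply: nQw => K cK Kx; apply: contrapT => Kw;
        apply: nK; exists K.
    exists (~` K, [set U | U `<=` K]); first split.
    - by apply: open_nbhs_nbhs; split => //; exact: closed_openC.
    - apply/near_powerset_filter_fromP; first by move=> ? ?; exact: subset_trans.
      by exists K => //; exists K.
    - by case=> i j [/= Ki jK] /jK.
  move=> D [DF _ [C DC]] /(_ _ DC) WC.
  have [K [Kx [oK cK]] KC] := DF _ DC.
  have KV : K `&` V = K `&` closure V.
    apply/seteqP; split=> t [Kt Vt]; split=> //; first exact: subset_closure.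
    by apply: contrapT => nVt; apply: (WC t) => //; exact: KC.
  have cKV : clopen (K `&` V).
    split; first exact: openI.
    by rewrite KV; apply: closedI => //; exact: closed_closure.
  have [_ Vz] := Qz _ cKV (conj Kx (PV _ Px)).
  exact: VR (subset_closure Vz) Rz.
have conQ : connected Q.
  move=> B [b Bb] [C oC BC] [D cD BD].
  have cB : closed B by rewrite BD; exact: closedI.
  have cQB : closed (Q `&` ~` C) by apply: closedI => //; exact: open_closedC.
  have disj : B `&` (Q `&` ~` C) = set0.
    by rewrite BC; apply/seteqP; split=> // t [[_ Ct] [_ /(_ Ct)]].
  have QB : Q `<=` B `|` (Q `&` ~` C).
    by move=> t Qt; rewrite BC; case: (pselect (C t)) => Ct; [left|right].
  have BQ : B `<=` Q by rewrite BC => t [].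
  apply/seteqP; split=> // z Qz; case: (QB _ Qz) => // QCz; exfalso.
  case: (QB _ Qx) => [Bx|QCx]; first exact: sepQ cB cQB disj QB Bx Qz QCz.
  apply: (sepQ _ _ b cQB cB) => //; first by rewrite setIC.
    by rewrite setUC.
  by rewrite BC in Bb; case: Bb.
have : connected_component [set: T] x y by exists Q.
by rewrite tdT// => /esym.
Qed.

Section Quotient.
Variables (G : profiniteGroupType) (N : closedNormal G).
Implicit Types x y z : G.
Local Notation inN := (closedNormal_set N).

Let N1 : inN 1. Proof. by case: (closedNormal_subgroup N). Qed.
Let NF x y : inN x -> inN y -> inN (x / y).
Proof. by case: (closedNormal_subgroup N) => _; apply. Qed.
Let NV x : inN x -> inN x^-1. Proof. by rewrite -(mul1g x^-1); apply: NF. Qed.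
Let NM x y : inN x -> inN y -> inN (x * y).
Proof. by move=> Nx Ny; rewrite -(invgK y); apply: NF => //; exact: NV. Qed.
Let NJ x y : inN x -> inN (x ^ y). Proof. exact: closedNormal_normal. Qed.

Definition coset_rel : rel G := fun x y => `[< inN (x^-1 * y) >].

Fact coset_rel_equiv : equiv_class_of coset_rel.
Proof.
split=> [x|x y|y x z].
- by apply/asboolP; rewrite mulVg.
- by apply/asboolP/asboolP => /NV; rewrite invgM invgK.
- move=> /asboolP xy /asboolP yz; apply/asboolP.
  by have := NM xy yz; rewrite mulgA mulgK.
Qed.

Canonical coset_equiv := EquivRelPack coset_rel_equiv.

Definition quotientGroup : Type := quotient_topology {eq_quot coset_equiv}.

HB.instance Definition _ := Topological.copy quotientGroup
  (quotient_topology {eq_quot coset_equiv}).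
HB.instance Definition _ := Quotient.copy quotientGroup
  (quotient_topology {eq_quot coset_equiv}).

Local Notation Q := quotientGroup.

Lemma pi_quotientP x y : \pi_Q x = \pi_Q y <-> inN (x^-1 * y).
Proof.
have e : reflect (\pi_Q x = \pi_Q y) (coset_rel x y).
  exact: (@eqmodP _ coset_equiv).
by split=> [/e/asboolP|Nxy] //; apply/e/asboolP.
Qed.

Lemma repr_quotientP x : inN (x^-1 * repr (\pi_Q x)).
Proof. by apply/pi_quotientP; rewrite reprK. Qed.

Lemma quotient_ind (P : Q -> Prop) : (forall x, P (\pi_Q x)) -> forall a, P a.
Proof. by move=> Ppi a; rewrite -[a]reprK; exact: Ppi. Qed.

Definition quotient_one : Q := \pi_Q 1.
Definition quotient_mul (a b : Q) : Q := \pi_Q (repr a * repr b).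
Definition quotient_inv (a : Q) : Q := \pi_Q (repr a)^-1.

Lemma quotient_mulE x y : quotient_mul (\pi_Q x) (\pi_Q y) = \pi_Q (x * y).
Proof.
rewrite /quotient_mul; symmetry; apply/pi_quotientP.
set x' := repr _; set y' := repr _.
have Nx : inN (x^-1 * x') by exact: repr_quotientP.
have Ny : inN (y^-1 * y') by exact: repr_quotientP.
suff -> : (x * y)^-1 * (x' * y') = (x^-1 * x') ^ y * (y^-1 * y').
  by apply: NM => //; exact: NJ.
by rewrite /conjg invgM !mulgA mulgK.
Qed.

Lemma quotient_invE x : quotient_inv (\pi_Q x) = \pi_Q x^-1.
Proof.
rewrite /quotient_inv; symmetry; apply/pi_quotientP.
set x' := repr _.
have Nx : inN (x^-1 * x') by exact: repr_quotientP.
suff -> : x^-1^-1 * x'^-1 = ((x^-1 * x')^-1) ^ x^-1 by exact/NJ/NV.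
by rewrite /conjg invgM !invgK !mulgA mulgK.
Qed.

Fact quotient_mulA : associative quotient_mul.
Proof.
by move=> a b c; elim/quotient_ind: a => x; elim/quotient_ind: b => y; elim/quotient_ind: c => z; rewrite !quotient_mulE mulgA.
Qed.
Fact quotient_mul1g : left_id quotient_one quotient_mul.
Proof. by move=> a; elim/quotient_ind: a => x; rewrite quotient_mulE mul1g. Qed.
Fact quotient_mulg1 : right_id quotient_one quotient_mul.
Proof. by move=> a; elim/quotient_ind: a => x; rewrite quotient_mulE mulg1. Qed.
Fact quotient_mulVg : left_inverse quotient_one quotient_inv quotient_mul.
Proof. by move=> a; elim/quotient_ind: a => x; rewrite quotient_invE quotient_mulE mulVg. Qed.
Fact quotient_mulgV : right_inverse quotient_one quotient_inv quotient_mul.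
Proof. by move=> a; elim/quotient_ind: a => x; rewrite quotient_invE quotient_mulE mulgV. Qed.

HB.instance Definition _ := isGroup.Build Q quotient_mulA quotient_mul1g
  quotient_mulg1 quotient_mulVg quotient_mulgV.

Lemma pi_quotient_continuous : continuous (\pi_Q : G -> Q).
Proof. exact: pi_continuous. Qed.

Lemma mull_continuous x : continuous (fun y => x * y).
Proof.
move=> y; apply: (@continuous_comp _ _ _ (fun y => (x, y)) (fun p : G * G => p.1 * p.2)).
  by apply: cvg_pair => /=; [exact: cvg_cst|exact: cvg_id].
exact: mulg_continuous.
Qed.

Lemma mulr_continuous x : continuous (fun y => y * x).
Proof.
move=> y; apply: (@continuous_comp _ _ _ (fun y => (y, x)) (fun p : G * G => p.1 * p.2)).
  by apply: cvg_pair => /=; [exact: cvg_id|exact: cvg_cst].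
exact: mulg_continuous.
Qed.

Lemma pi_quotient_open (U : set G) : open U -> open (\pi_Q @` U).
Proof.
move=> oU; rewrite /open/= /quotient_open.
have -> : \pi_Q @^-1` (\pi_Q @` U) =
    \bigcup_(n in (N : set G)) ((fun y => y * n) @^-1` U).
  apply/seteqP; split=> [y [x Ux /esym/pi_quotientP Nyx]|y [n Nn Uyn]].
    by exists (y^-1 * x) => //=; rewrite mulgA mulgV mul1g.
  by exists (y * n) => //; apply/esym/pi_quotientP; rewrite mulgA mulVg mul1g.
apply: bigcup_open => n _; exact: (continuousP _).1 (@mulr_continuous n) _ oU.
Qed.

Fact quotient_mul_continuous : continuous (fun p : Q * Q => p.1 * p.2).
Proof.
move=> [a b] /= W; elim/quotient_ind: a => x; elim/quotient_ind: b => y.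
rewrite nbhsE => -[V [oV]] /=; rewrite [_ * _]quotient_mulE => Vxy VW.
have /(mulg_continuous (x, y)) : nbhs (x * y) (\pi_Q @^-1` V).
  by apply: open_nbhs_nbhs; split; [exact: oV|exact: Vxy].
move=> [[A B] [/= nA nB] ABV].
rewrite !nbhsE in nA nB.
case: nA nB => A' [oA A'x] A'A [B' [oB B'y] B'B].
suff : filter_prod (nbhs (\pi_Q x)) (nbhs (\pi_Q y))
    [set p : Q * Q | W (p.1 * p.2)] by [].
exists (\pi_Q @` A', \pi_Q @` B').
  split; apply: open_nbhs_nbhs; split.
  - exact: pi_quotient_open.
  - by exists x.
  - exact: pi_quotient_open.
  - by exists y.
move=> [c d] /= [[u A'u <-] [v B'v <-]]; rewrite [_ * _]quotient_mulE.
by apply/VW/(ABV (u, v)); split; [exact: A'A|exact: B'B].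
Qed.

Fact quotient_inv_continuous : continuous (fun a : Q => a^-1).
Proof.
apply/quotient_continuous => x.
have -> : (fun a : Q => a^-1) \o \pi_Q = \pi_Q \o (fun x => x^-1).
  by apply/funext => z /=; exact: quotient_invE.
by apply: continuous_comp; [exact: invg_continuous|exact: pi_quotient_continuous].
Qed.

HB.instance Definition _ := PreTopologicalGroup_isTopologicalGroup.Build Q
  quotient_mul_continuous quotient_inv_continuous.

Fact quotient_compact : compact [set: Q].
Proof.
have <- : \pi_Q @` [set: G] = [set: Q].
  by apply/seteqP; split=> // a _; elim/quotient_ind: a => x; exists x.
apply: continuous_compact; last exact: profinite_compact.
by apply: continuous_subspaceT; exact: pi_quotient_continuous.
Qed.

Fact quotient_zero_dimensional : zero_dimensional Q.
Proof.
have zG : zero_dimensional G.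
  apply: compact_totally_disconnected; first exact: profinite_compact.
    exact: profinite_hausdorff.
  exact: profinite_totally_disconnected.
move=> a b; elim/quotient_ind: a => x; elim/quotient_ind: b => y /eqP xy.
(* A clopen neighbourhood of x missing the coset yN. *)
have [V [cV Vx VyN]] : exists V, [/\ clopen V, V x & forall n, inN n -> ~ V (y * n)].
  have : nbhs x (~` [set z | inN (y^-1 * z)]).
    apply: open_nbhs_nbhs; split; last by move=> /= /pi_quotientP /esym.
    apply: closed_openC.
    apply: (continuous_closedP _).1 (@mull_continuous y^-1) _ _.
    exact: closedNormal_closed.
  move=> /(zero_dimensional_cvg (@profinite_hausdorff G) zG
    (@profinite_compact G))[V [Vx cV] VyN].
  exists V; split=> // n Nn Vyn; apply: (VyN _ Vyn).
  by rewrite /= mulgA mulVg mul1g.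
case: cV => oV cV.
have VN : \pi_Q @^-1` (\pi_Q @` V) =
    (fun p : G * G => p.1 * p.2) @` (V `*` N).
  apply/seteqP; split=> [z [v Vv /pi_quotientP Nvz]|z [[v n] [/= Vv Nn] <-]].
    by exists (v, v^-1 * z) => //=; rewrite mulgA mulgV mul1g.
  by exists v => //; apply/pi_quotientP; rewrite mulgA mulVg mul1g.
have cVN : closed (\pi_Q @^-1` (\pi_Q @` V)).
  rewrite VN; apply: compact_closed; first exact: profinite_hausdorff.
  apply: continuous_compact.
    by apply: continuous_subspaceT; exact: mulg_continuous.
  by apply: compact_setX; apply: (subclosed_compact _ (@profinite_compact G)) => //;
    exact: closedNormal_closed.
exists (\pi_Q @` V); split; first split.
- exact: pi_quotient_open.
- by rewrite -openC; exact: (closed_openC cVN).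
- by exists x.
- move=> [v Vv /esym/pi_quotientP Nyv]; apply: (VyN _ Nyv).
  by rewrite mulgA mulgV mul1g.
Qed.

HB.instance Definition _ := TopologicalGroup_isProfinite.Build Q
  quotient_compact (zero_dimensional_hausdorff quotient_zero_dimensional)
  (zero_dimension_totally_disconnected quotient_zero_dimensional).

End Quotient.

Definition homomorphism (G H : profiniteGroupType) (f : G -> H) :=
  monoid_morphism f /\ continuous f.

Definition epimorphism (G H : profiniteGroupType) (f : G -> H) :=
  homomorphism f /\ set_surj [set: G] [set: H] f.

Definition isomorphism (G H : profiniteGroupType) (f : G -> H) :=
  homomorphism f /\
  exists g : H -> G, [/\ homomorphism g, cancel f g & cancel g f].

Definition ker (G H : profiniteGroupType) (f : G -> H) : set G := f @^-1` [set 1].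

Definition quotient_of (E B : profiniteGroupType) :=
  exists f : E -> B, epimorphism f.

(* The map G / N -> H induced by f; meaningful when N `<=` ker f, see
   [inducedE]. *)
Definition induced (G H : profiniteGroupType) (N : closedNormal G) (f : G -> H) :
  quotientGroup N -> H := f \o repr.

Lemma inducedE (G H : profiniteGroupType) (N : closedNormal G) (f : G -> H) (x : G) :
  homomorphism f -> N `<=` ker f ->
  induced f (\pi_(quotientGroup N) x) = f x.
Proof.
move=> [[_ fM] _] /(_ _ (repr_quotientP N x)); rewrite /ker/= /induced/=.
set y := repr _ => /(congr1 (fun z => f x * z)).
by rewrite mulg1 -fM mulgA mulgV mul1g.
Qed.

Section Covers.
Variable G : profiniteGroupType.

Definition dominates (H E : profiniteGroupType) (eta : H -> G) (pi : E -> G) :=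
  exists2 psi : H -> E, epimorphism psi & eta = pi \o psi.

Definition embedding_property (E : profiniteGroupType) :=
  forall (A B : profiniteGroupType) (alpha : B -> A) (phi : E -> A),
    finite_set [set: A] -> quotient_of E A ->
    finite_set [set: B] -> quotient_of E B ->
    epimorphism alpha -> epimorphism phi ->
    exists2 gamma : E -> B, epimorphism gamma & alpha \o gamma = phi.

Definition embedding_cover (E : profiniteGroupType) (eps : E -> G) :=
  epimorphism eps /\ embedding_property E.

Definition I_cover (H : profiniteGroupType) (eta : H -> G) :=
  epimorphism eta /\
  forall (E : profiniteGroupType) (eps : E -> G),
    embedding_cover eps -> dominates eps eta.

Definition smallest_embedding_cover (E : profiniteGroupType) (eps : E -> G) :=
  embedding_cover eps /\ I_cover eps.

(* [Ef B] : the isomorphism type of B belongs to E_f(G). *)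
Definition Ef (B : profiniteGroupType) :=
  finite_set [set: B] /\
  exists (E : profiniteGroupType) (eps : E -> G),
    smallest_embedding_cover eps /\ quotient_of E B.

End Covers.

Section Squares.
Variables (H B G A : profiniteGroupType).
Variables (beta : H -> B) (eta : H -> G) (alpha : B -> A) (phi : G -> A).

(* The map (beta, eta) is a continuous homomorphism between compact Hausdorff
   groups, so bijectivity onto the fiber product makes it an isomorphism of
   topological groups. *)
Definition cartesian :=
  alpha \o beta = phi \o eta /\
  set_bij [set: H] [set p : B * G | alpha p.1 = phi p.2]
    (fun h => (beta h, eta h)).

Definition compact_square :=
  forall K : set H, closed K -> is_subgroup K ->
    beta @` K = [set: B] -> eta @` K = [set: G] -> K = [set: H].

End Squares.

Definition basic_cover (H G : profiniteGroupType) (eta : H -> G) :=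
  epimorphism eta /\
  exists (B A : profiniteGroupType) (beta : H -> B) (alpha : B -> A) (phi : G -> A),
    [/\ epimorphism beta, epimorphism alpha & epimorphism phi] /\
    [/\ Ef G B, cartesian beta eta alpha phi & compact_square beta eta].

Definition indecomposable (H G : profiniteGroupType) (eta : H -> G) :=
  [/\ epimorphism eta, ~ isomorphism eta &
    forall (Q : profiniteGroupType) (eta1 : H -> Q) (eta2 : Q -> G),
      epimorphism eta1 -> epimorphism eta2 -> eta = eta2 \o eta1 ->
      isomorphism eta1 \/ isomorphism eta2].

(* Intersecting with [ker pi] only matters when the family of N is empty. *)
Definition Mker (H G : profiniteGroupType) (pi : H -> G) : set H :=
  ker pi `&`
  [set h | forall N : closedNormal H,
    N `<=` ker pi -> indecomposable (@induced _ _ N pi) -> closedNormal_set N h].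

Definition fundamental (H G : profiniteGroupType) (pi : H -> G) :=
  epimorphism pi /\ Mker pi = [set 1].

(* Up to isomorphism, Q is H / Mker rho, q the quotient map and f the map
   induced by rho. *)
Definition is_fundament (H G Q : profiniteGroupType) (rho : H -> G)
    (f : Q -> G) (q : H -> Q) :=
  [/\ epimorphism q, ker q = Mker rho, epimorphism f & f \o q = rho].

(* [pi_ k] is the map usually numbered k + 1, from G_(k + 1) to G_k. *)
Definition fundament_series (H : profiniteGroupType)
    (G_ : nat -> profiniteGroupType) (pi : H -> G_ 0)
    (pi_ : forall k, G_ k.+1 -> G_ k) (rho_ : forall k, H -> G_ k) :=
  rho_ 0 = pi /\ forall k, is_fundament (rho_ k) (pi_ k) (rho_ k.+1).

(* Main.v *)
Require Import Defs.
From HB Require Import structures.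
From mathcomp Require Import all_boot.
From mathcomp Require Import finmap.
From mathcomp Require Import all_classical.
From mathcomp Require Import topology.

Set Implicit Arguments.
Unset Strict Implicit.
Unset Printing Implicit Defensive.

Local Open Scope classical_set_scope.
Local Open Scope group_scope.

(** Write P for G_(k-1), rho : H -> P for the projection and R for its kernel.

    Covers are studied on the closed subgroups of H.  An open normal N gives a
    cartesian square with corners H / (N & R), H / N, P and H / NR; it is
    compact when no proper closed subgroup K containing N & R satisfies
    KR = KN = H ([compact_over R N]).  A cover tau of P with finite kernel that
    is dominated by rho is such a fibre product for suitable N.  So tau is
    basic as soon as (i) every open normal subgroup of H contains one that is
    compact over R, a property called atomicity of rho, and (ii) the finite
    quotients of H belong to E_f(P): by (i), N can be shrunk to a subgroup that
    is compact over R without changing N & R ([isolated_above]).  Both hold,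
    which is the main part of (d) => (a).  For (a) => (b), embedding covers lift
    through the square by their embedding property ([basic_I_cover]);
    (b) => (c) holds as rho is an embedding cover; and (c) => (d) holds because
    M(tau) = 1, so that the map H -> H' kills M(rho) ([Mker_map]).

    For (ii) and for (i) with k = 1, a smallest embedding cover is constructed
    inside a given embedding cover X -> P ([smallest_cover_exists]).  Start
    from P and go up by transfinite steps inside X: at a quotient X / D, add a
    fibre product with a finite quotient X / M that is attached by a compact
    square and is already isomorphic to a quotient of X / D.  When no such step
    remains, X / D has the embedding property ([no_step_embedding]).  An
    arbitrary embedding cover of P lifts through each step, by its embedding
    property and by compactness ([step_lift]), and hence through all of them.
    Compact squares compose ([atomic_step]), so the result is atomic.  A
    smallest embedding cover is a quotient of this one and therefore atomic
    too, which is (i) for k = 1.  Over G_(k-1) the construction yields a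
    smallest embedding cover which, seen as an embedding cover of G, dominates
    H -> G; this is (ii).

    For k > 1, (i) is a property of the fundament alone: if S = M(rho) for any
    cover rho, then all open normal subgroups are compact over S
    ([fundament_compact]).  An obstruction K may be taken maximal; then
    S / (K & S) is a chief factor, and semisimplicity of ker rho / S ([socle])
    produces an indecomposable quotient of rho whose kernel does not contain
    S, against the definition of M(rho). *)

(** * Subgroups as sets *)

Definition prodset (G : groupType) (A B : set G) : set G :=
  [set a * b | a in A & b in B].
Notation "A *s B" := (prodset A B) (at level 40, left associativity).

Section Subgroups.
Variable G : groupType.
Implicit Types (A B K N : set G) (x y : G).

Lemma mem_one K : is_subgroup K -> K 1. Proof. by case. Qed.
Lemma mem_inv K x : is_subgroup K -> K x -> K x^-1.
Proof. by move=> [K1 KF] Kx; rewrite -[x^-1]mul1g; exact: KF. Qed.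
Lemma mem_mul K x y : is_subgroup K -> K x -> K y -> K (x * y).
Proof. by move=> sK Kx Ky; rewrite -[y]invgK; apply: sK.2 => //; exact: mem_inv. Qed.

Lemma mem_invE K x : is_subgroup K -> K x^-1 -> K x.
Proof. by move=> sK /(mem_inv sK); rewrite invgK. Qed.

Lemma mem_mulIl K x y : is_subgroup K -> K x -> K (x * y) -> K y.
Proof.
by move=> sK Kx /(mem_mul sK (mem_inv sK Kx)); rewrite mulgA mulVg mul1g.
Qed.
Lemma mem_mulIr K x y : is_subgroup K -> K y -> K (x * y) -> K x.
Proof. by move=> sK Ky /sK.2/(_ Ky); rewrite mulgK. Qed.

Lemma mem_conj N x y : is_normal N -> N x -> N (y * x * y^-1).
Proof. by move=> nN /(nN _ y^-1); rewrite /conjg invgK !mulgA. Qed.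
Lemma mem_conjV N x y : is_normal N -> N x -> N (y^-1 * x * y).
Proof. by move=> nN /(nN _ y); rewrite /conjg !mulgA. Qed.

Lemma subgroupI A B : is_subgroup A -> is_subgroup B -> is_subgroup (A `&` B).
Proof.
move=> sA sB; split; first by split; exact: mem_one.
by move=> x y [Ax Bx] [Ay By]; split; [exact: sA.2|exact: sB.2].
Qed.

Lemma normalI A B : is_normal A -> is_normal B -> is_normal (A `&` B).
Proof. by move=> nA nB x y [/nA ? /nB ?]; split. Qed.

Lemma prodset_subgroup K N :
  is_subgroup K -> is_subgroup N -> is_normal N -> is_subgroup (K *s N).
Proof.
move=> sK sN nN; split.
  by exists 1; [exact: mem_one|exists 1; [exact: mem_one|rewrite mulg1]].
move=> _ _ [k Kk [n Nn <-]] [l Kl [m Nm <-]].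
exists (k * l^-1); first exact: sK.2.
exists (l * (n * m^-1) * l^-1); first by apply: mem_conj => //; exact: sN.2.
by rewrite invgM !mulgA mulgVK.
Qed.

Lemma prodset_normal A N :
  is_normal A -> is_normal N -> is_normal (A *s N).
Proof.
move=> nA nN _ y [a Aa [n Nn <-]]; exists (a ^ y); first exact: nA.
by exists (n ^ y); [exact: nN|rewrite -conjMg].
Qed.

Lemma prodset_subl K N : is_subgroup N -> K `<=` K *s N.
Proof. by move=> sN x Kx; exists x => //; exists 1; [exact: mem_one|rewrite mulg1]. Qed.
Lemma prodset_subr K N : is_subgroup K -> N `<=` K *s N.
Proof. by move=> sK x Nx; exists 1; [exact: mem_one|exists x; rewrite ?mul1g]. Qed.

Lemma prodset_sub K N L : is_subgroup L -> K `<=` L -> N `<=` L -> K *s N `<=` L.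
Proof. by move=> sL KL NL _ [k /KL ? [n /NL ? <-]]; exact: mem_mul. Qed.

Lemma prodsetS A B A' B' : A `<=` A' -> B `<=` B' -> A *s B `<=` A' *s B'.
Proof. by move=> AA BB _ [a /AA ? [b /BB ? <-]]; exists a => //; exists b. Qed.



Lemma prodset_full K N x : K *s N = setT -> exists k n, [/\ K k, N n & x = k * n].
Proof.
move=> e; have [k Kk [n Nn <-]] : (K *s N) x by rewrite e.
by exists k, n.
Qed.

Lemma prodset_fullP K N :
  (forall x, exists k, K k /\ N (k^-1 * x)) -> K *s N = setT.
Proof.
move=> h; apply/seteqP; split=> // x _; have [k [Kk Nkx]] := h x.
by exists k => //; exists (k^-1 * x); rewrite // mulgA mulgV mul1g.
Qed.

Lemma prodset_fullS K N K' N' :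
  K `<=` K' -> N `<=` N' -> K *s N = setT -> K' *s N' = setT.
Proof. by move=> KK NN e; apply/seteqP; split=> // x _; apply: (prodsetS KK NN); rewrite e. Qed.

(** The supplement K of M normalises K `&` D because D is normal.  So does M,
    since the commutators of M and D lie in M `&` D, hence in K. *)
Lemma supplement_normal K D M : is_subgroup K -> is_subgroup D -> is_normal D ->
  is_subgroup M -> is_normal M -> M `&` D `<=` K -> K *s M = setT ->
  is_normal (K `&` D).
Proof.
move=> sK sD nD sM nM MDK KM x y [Kx Dx].
have [k [m [Kk Mm ->]]] := prodset_full y KM; rewrite conjgM.
have : (K `&` D) (x ^ k).
  by split; [do 2?apply: mem_mul => //; exact: mem_inv|exact: nD].
move: (x ^ k) => z [Kz Dz]; split; last exact: nD.
have -> : z ^ m = z * (z^-1 * z ^ m) by rewrite mulgA mulgV mul1g.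
apply: mem_mul => //; apply: MDK; split; last first.
  by apply: mem_mul => //; [exact: mem_inv|exact: nD].
rewrite /conjg !mulgA; apply: mem_mul => //.
by apply: mem_conjV => //; exact: mem_inv.
Qed.



End Subgroups.

(** * Compactness arguments *)

Section Compactness.
Variable T : topologicalType.
Hypothesis cT : compact [set: T].

Lemma directed_compact (F : set (set T)) (O : set T) :
  (forall A, F A -> closed A) -> F !=set0 ->
  (forall A B, F A -> F B -> exists2 C, F C & C `<=` A `&` B) ->
  open O -> \bigcap_(A in F) A `<=` O -> exists2 A, F A & A `<=` O.
Proof.
move=> cF [A0 FA0] dF oO FO.
have cO : compact (~` O).
  by apply: (subclosed_compact _ cT) => //; exact: open_closedC.
have FF : Filter (filter_from F (fun A => [set B : set T | B `<=` A])).
  apply: filter_from_filter; first by exists A0.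
  move=> A B FA FB; have [C FC CAB] := dF _ _ FA FB; exists C => // D DC.
  by split; apply: subset_trans DC _ => x /CAB[].
move/compact_near_coveringP : cO => /(_ _ _ (fun B x => ~ B x) FF)[].
  move=> x Ox.
  have [A FA nAx] : exists2 A, F A & ~ A x.
    by apply: contrapT => nA; apply/Ox/FO => A FA; apply: contrapT => nAx; apply: nA; exists A.
  exists (~` A, [set B | B `<=` A]) => /=; first split.
  - by apply: open_nbhs_nbhs; split => //; apply: closed_openC; exact: cF.
  - by exists A.
  - by move=> [y B] /= [nAy BA] /BA.
move=> A FA /(_ A (@subset_refl _ _)) OA; exists A => // x Ax.
by apply: contrapT => nOx; exact: OA nOx Ax.
Qed.

Lemma chain_compact (F : set (set T)) (O : set T) :
  (forall A, F A -> closed A) -> F !=set0 -> total_on F subset ->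
  open O -> \bigcap_(A in F) A `<=` O -> exists2 A, F A & A `<=` O.
Proof.
move=> cF F0 tF; apply: directed_compact => // A B FA FB.
by case: (tF _ _ FA FB) => AB; [exists A|exists B] => // x; split=> //; exact: AB.
Qed.

Lemma compact_discrete_finite : (forall x : T, open [set x]) -> finite_set [set: T].
Proof.
move=> oT.
have FF : Filter (filter_from (@finite_set T) (fun A => [set B : set T | A `<=` B])).
  apply: filter_from_filter; first by exists set0; exact: finite_set0.
  move=> A B FA FB; exists (A `|` B); first by rewrite finite_setU.
  by move=> C ABC; split=> x ?; apply: ABC; [left|right].
move/compact_near_coveringP : cT => /(_ _ _ (fun B x => B x) FF)[].
  move=> x _; exists ([set x], [set B | [set x] `<=` B]) => /=; first split.
  - by apply: open_nbhs_nbhs; split => //; exact: oT.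
  - by exists [set x] => //; exact: finite_set1.
  - by move=> [y B] /= [-> xB]; exact: xB.
by move=> A fA /(_ A (@subset_refl _ _)) TA; exact: sub_finite_set fA.
Qed.

End Compactness.

(** Adjoining the empty set to the members of P above A0 makes the union of
    the empty chain harmless, so only nonempty chains have to be checked. *)
Lemma Zorn_above (T : Type) (P : set (set T)) (A0 : set T) : P A0 ->
  (forall F : set (set T), F `<=` P -> F !=set0 -> total_on F subset ->
    P (\bigcup_(A in F) A)) ->
  exists A, [/\ P A, A0 `<=` A & forall B, P B -> A `<=` B -> B = A].
Proof.
move=> PA0 chP.
pose Q := [set A | A = set0 \/ P A /\ A0 `<=` A].
have [F FQ tF|A [QA maxA]] := @Zorn_bigcup T Q.
  have [[A [FA A_neq0]]|nA] := pselect (exists A, F A /\ A <> set0); last first.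
    left; apply/seteqP; split=> // x [A FA Ax]; apply: nA; exists A; split=> // A_eq0.
    by rewrite A_eq0 in Ax.
  right; split; last by case: (FQ _ FA) => // -[_ A0A] x /A0A; exists A.
  have -> : \bigcup_(A in F) A = \bigcup_(A in F `\ set0) A.
    apply/seteqP; split=> x [B FB Bx]; last by exists B => //; case: FB.
    by exists B => //; split=> // B0; rewrite B0 in Bx.
  apply: chP; first by move=> B [/FQ[]// []].
    by exists A.
  by move=> B C [FB _] [FC _]; exact: tF.
have maxA' B : P B -> A0 `<=` B -> A `<=` B -> B = A.
  move=> PB A0B AB; apply: contrapT => nBA; apply: (maxA B); last by right.
  by split=> // BA; apply: nBA; apply/seteqP; split.
case: QA => [A_eq0|[PA A0A]]; last first.
  by exists A; split=> // B PB AB; apply: maxA' => //; exact: subset_trans AB.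
exists A0; split=> // B PB A0B; rewrite [B]maxA' //; last by rewrite A_eq0; exact: sub0set.
by rewrite [A0]maxA' //; rewrite A_eq0; exact: sub0set.
Qed.

Lemma Zorn_bigcap (T : Type) (P : set (set T)) (A0 : set T) : P A0 ->
  (forall F : set (set T), F `<=` P -> F !=set0 -> total_on F subset ->
    P (\bigcap_(A in F) A)) ->
  exists A, [/\ P A, A `<=` A0 & forall B, P B -> B `<=` A -> B = A].
Proof.
move=> PA0 chP.
have [||C [PC AC maxC]] := @Zorn_above T [set C | P (~` C)] (~` A0).
- by rewrite /= setCK.
- move=> F FP [A FA] tF /=; rewrite setC_bigcup -(bigcap_image F setC id); apply: chP.
  + by move=> _ [B /FP PB <-].
  + by exists (~` A), A.
  + move=> _ _ [B FB <-] [D FD <-].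
    by case: (tF _ _ FB FD) => /subsetC; [right|left].
- exists (~` C); split=> //; first by rewrite -[A0]setCK; exact: subsetC.
  move=> B PB BC; rewrite -[B]setCK [~` B]maxC//=; first by rewrite setCK.
  by rewrite -[C]setCK; exact: subsetC.
Qed.

(** * Topology of profinite groups *)

Definition csubgroup (G : profiniteGroupType) (K : set G) := closed K /\ is_subgroup K.
Definition cnormal (G : profiniteGroupType) (K : set G) :=
  [/\ closed K, is_subgroup K & is_normal K].
Definition onormal (G : profiniteGroupType) (K : set G) :=
  [/\ open K, is_subgroup K & is_normal K].

Section Topology.
Variable G : profiniteGroupType.
Implicit Types (A B K N : set G).

Lemma compactG : compact [set: G]. Proof. exact: profinite_compact. Qed.

Lemma closed_compact A : closed A -> compact A.
Proof. by move=> cA; apply: (subclosed_compact cA compactG). Qed.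

Lemma shift_open K x : open K -> open [set y | K (x * y)].
Proof. by move=> oK; apply: (continuousP _).1 (@mull_continuous _ x) _ oK. Qed.

Lemma open_prodset A N : open A -> open (A *s N).
Proof.
move=> oA.
have -> : A *s N = \bigcup_(n in N) ((fun y => y * n^-1) @^-1` A).
  apply/seteqP; split=> [_ [a Aa [n Nn <-]]|y [n Nn Ayn]].
    by exists n => //=; rewrite mulgK.
  by exists (y * n^-1) => //; exists n => //; rewrite mulgVK.
by apply: bigcup_open => n _; apply: (continuousP _).1 (@mulr_continuous _ n^-1) _ oA.
Qed.

Lemma closed_prodset A B : closed A -> closed B -> closed (A *s B).
Proof.
move=> cA cB.
have -> : A *s B = (fun p : G * G => p.1 * p.2) @` (A `*` B).
  by apply/seteqP; split=> [_ [a Aa [b Bb <-]]|_ [[a b] [/= Aa Bb] <-]];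
    [exists (a, b)|exists a => //; exists b].
apply: compact_closed; first exact: profinite_hausdorff.
apply: continuous_compact; first by apply: continuous_subspaceT; exact: mulg_continuous.
by apply: compact_setX; exact: closed_compact.
Qed.

Lemma open_overgroup N K : open N -> N 1 -> N `<=` K -> is_subgroup K -> open K.
Proof.
move=> oN N1 NK sK; have -> : K = K *s N.
  apply/seteqP; split=> [x Kx|]; first by exists x => //; exists 1; rewrite ?mulg1.
  exact: prodset_sub.
have -> : K *s N = \bigcup_(k in K) [set y | N (k^-1 * y)].
  apply/seteqP; split=> [_ [k Kk [n Nn <-]]|x [k Kk Nx]].
    by exists k => //=; rewrite mulgA mulVg mul1g.
  by exists k => //; exists (k^-1 * x) => //; rewrite mulgA mulgV mul1g.
by apply: bigcup_open => k _; exact: shift_open.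
Qed.

Lemma open_subgroup_closed K : open K -> is_subgroup K -> closed K.
Proof.
move=> oK sK; rewrite -[K]setCK; apply: open_closedC.
have -> : ~` K = \bigcup_(x in ~` K) [set y | K (x^-1 * y)].
  apply/seteqP; split=> [x nKx|y [x nKx Kxy] Ky].
    by exists x => //=; rewrite mulVg; exact: mem_one.
  by apply: nKx; apply: mem_invE => //; apply: mem_mulIr Kxy.
by apply: bigcup_open => x _; exact: shift_open.
Qed.

Lemma onormal_cnormal N : onormal N -> cnormal N.
Proof. by move=> [oN sN nN]; split=> //; exact: open_subgroup_closed. Qed.

Lemma onormalI A B : onormal A -> onormal B -> onormal (A `&` B).
Proof. by move=> [? ? ?] [? ? ?]; split; [exact: openI|exact: subgroupI|exact: normalI]. Qed.

Lemma cnormalI A B : cnormal A -> cnormal B -> cnormal (A `&` B).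
Proof. by move=> [? ? ?] [? ? ?]; split; [exact: closedI|exact: subgroupI|exact: normalI]. Qed.



Lemma csubgroupM K N : csubgroup K -> cnormal N -> csubgroup (K *s N).
Proof. by move=> [? ?] [? ? ?]; split; [exact: closed_prodset|exact: prodset_subgroup]. Qed.

Lemma cnormalM A N : cnormal A -> cnormal N -> cnormal (A *s N).
Proof.
move=> [? ? ?] [? ? ?].
by split; [exact: closed_prodset|exact: prodset_subgroup|exact: prodset_normal].
Qed.

Lemma onormalM A N : onormal A -> cnormal N -> onormal (A *s N).
Proof.
move=> [? ? ?] [? ? ?].
by split; [exact: open_prodset|exact: prodset_subgroup|exact: prodset_normal].
Qed.

Lemma bigcap_cnormal (F : set (set G)) :
  (forall A, F A -> cnormal A) -> cnormal (\bigcap_(A in F) A).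
Proof.
move=> cF; split.
- by apply: closed_bigI => A /cF[].
- split; first by move=> A /cF[_ [? _] _].
  by move=> x y Fx Fy A FA; have [_ [_ sA] _] := cF _ FA; apply: sA; [exact: Fx|exact: Fy].
- by move=> x y Fx A FA; have [_ _ nA] := cF _ FA; apply: nA; exact: Fx.
Qed.

(** The subgroup of those g whose insertion in a product never changes its
    membership in a clopen set V is normal by construction and, by compactness
    of the pairs of outer factors, open. *)
Lemma onormal_basis (U : set G) : open U -> U 1 -> exists2 N, onormal N & N `<=` U.
Proof.
move=> oU U1.
have zG : zero_dimensional G.
  apply: compact_totally_disconnected; first exact: profinite_compact.
    exact: profinite_hausdorff.
  exact: profinite_totally_disconnected.
have nU : nbhs (1 : G) U by apply: open_nbhs_nbhs.
have [V [V1 [oV cV]] /= VU] := zero_dimensional_cvg (@profinite_hausdorff G) zG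
  (@profinite_compact G) nU.
pose N := [set g : G | forall a b, V (a * g * b) <-> V (a * b)].
have sN : is_subgroup N.
  split=> [a b|x y Nx Ny a b]; first by rewrite mulg1.
  by have := Nx a (y^-1 * b); have := Ny a (y^-1 * b); rewrite !mulgA mulgK; tauto.
exists N; last by move=> g /(_ 1 1); rewrite !mul1g !mulg1 => -[_ /(_ V1)/VU].
split=> //; last first.
  by move=> x y Nx a b; have := Nx (a * y^-1) (y * b); rewrite /conjg !mulgA mulgVK.
have /compact_near_coveringP cGG : compact [set: G * G].
  by rewrite -setXTT; apply: compact_setX; exact: compactG.
have ctr (p : (G * G) * G) : {for p, continuous (fun p : (G * G) * G => p.1.1 * p.2 * p.1.2)}.
  apply: (@continuous_comp _ _ _ (fun p : (G * G) * G => (p.1.1 * p.2, p.1.2))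
    (fun p : G * G => p.1 * p.2));
    last exact: mulg_continuous.
  apply: cvg_pair => /=.
    apply: (@continuous_comp _ _ _ (fun p : (G * G) * G => (p.1.1, p.2))
      (fun p : G * G => p.1 * p.2));
      last exact: mulg_continuous.
    apply: cvg_pair => /=; last exact: cvg_snd.
    by apply: continuous_comp; exact: cvg_fst.
  by apply: continuous_comp; [exact: cvg_fst|exact: cvg_snd].
have key (W : set G) (p : G * G) : open W -> W (p.1 * p.2) ->
    \forall q \near p & g \near (1 : G), W (q.1 * g * q.2) /\ W (q.1 * q.2).
  move=> oW Wp.
  have nW : nbhs (p.1 * p.2) W by apply: open_nbhs_nbhs.
  have h1 : \forall q \near p & g \near (1 : G), W (q.1 * g * q.2).
    by apply: (ctr (p, 1)) => /=; rewrite mulg1.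
  have h2 : \forall q \near p & g \near (1 : G), W (q.1 * q.2).
    have /= h := @mulg_continuous G p _ nW.
    by exists ([set q : G * G | W (q.1 * q.2)], setT); [split => //; exact: filterT|case=> ? ? []].
  by apply: filterS2 h1 h2 => -[q g].
have Nn : \forall g \near (1 : G),
    [set: G * G] `<=` [set p | V (p.1 * g * p.2) <-> V (p.1 * p.2)].
  apply: (cGG _ (nbhs (1 : G)) (fun g p => V (p.1 * g * p.2) <-> V (p.1 * p.2))) => p _.
  have [Vp|nVp] := pselect (V (p.1 * p.2)).
    by apply: filterS (key V p oV Vp) => -[q g] /= [].
  by apply: filterS (key _ p (closed_openC cV) nVp) => -[q g] /= [].
have NN : nbhs (1 : G) N.
  apply: filterS Nn => g Ng a b; exact: (Ng (a, b)).
move: NN; rewrite nbhsE => -[W [oW W1] WN].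
exact: open_overgroup oW W1 WN sN.
Qed.
End Topology.

(** * Homomorphisms *)

Section Homomorphisms.
Variables (G H : profiniteGroupType) (f : G -> H).
Hypothesis hf : homomorphism f.
Implicit Types (x y : G).

Lemma hom_one : f 1 = 1. Proof. by case: hf => -[]. Qed.
Lemma hom_mul x y : f (x * y) = f x * f y. Proof. by case: hf => -[]. Qed.
Lemma hom_inv x : f x^-1 = (f x)^-1.
Proof. by apply: (mulgI (f x)); rewrite -hom_mul !mulgV hom_one. Qed.

Lemma hom_preimage_closed (A : set H) : closed A -> closed (f @^-1` A).
Proof. by move=> cA; apply: (continuous_closedP _).1 cA; case: hf. Qed.
Lemma hom_preimage_open (A : set H) : open A -> open (f @^-1` A).
Proof. by move=> oA; apply: (continuousP _).1 oA; case: hf. Qed.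

Lemma hom_preimage_subgroup (A : set H) : is_subgroup A -> is_subgroup (f @^-1` A).
Proof.
move=> sA; split; first by rewrite /preimage/= hom_one; exact: mem_one.
by move=> x y; rewrite /preimage/= hom_mul hom_inv; exact: sA.2.
Qed.
Lemma hom_preimage_normal (A : set H) : is_normal A -> is_normal (f @^-1` A).
Proof.
by move=> nA x y /(nA _ (f y)); rewrite /preimage/= /conjg !hom_mul hom_inv.
Qed.

Lemma preimage_cnormal (A : set H) : cnormal A -> cnormal (f @^-1` A).
Proof.
move=> [? ? ?].
by split;
  [exact: hom_preimage_closed|exact: hom_preimage_subgroup|exact: hom_preimage_normal].
Qed.
Lemma preimage_onormal (A : set H) : onormal A -> onormal (f @^-1` A).
Proof.
move=> [? ? ?].
by split;
  [exact: hom_preimage_open|exact: hom_preimage_subgroup|exact: hom_preimage_normal].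
Qed.

Lemma image_closed (A : set G) : closed A -> closed (f @` A).
Proof.
move=> cA; apply: compact_closed; first exact: profinite_hausdorff.
apply: continuous_compact; last exact: closed_compact.
by apply: continuous_subspaceT; case: hf.
Qed.

Lemma image_subgroup (A : set G) : is_subgroup A -> is_subgroup (f @` A).
Proof.
move=> sA; split; first by exists 1; [exact: mem_one|exact: hom_one].
by move=> _ _ [x Ax <-] [y Ay <-]; exists (x / y); [exact: sA.2|rewrite hom_mul hom_inv].
Qed.



Lemma cnormal1 (K : profiniteGroupType) : cnormal [set (1 : K)].
Proof.
split.
- apply: accessible_closed_set1; apply: hausdorff_accessible.
  exact: profinite_hausdorff.
- by split=> // _ _ -> ->; rewrite mulgV.
- by move=> _ y -> /=; rewrite /conjg mul1g mulVg.
Qed.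

Lemma ker_cnormal : cnormal (ker f).
Proof. by apply: preimage_cnormal; exact: cnormal1. Qed.

Lemma ker_eq x y : ker f (x^-1 * y) <-> f x = f y.
Proof.
rewrite /ker/= hom_mul hom_inv; split=> [/(congr1 (fun z => f x * z))|->]; last by rewrite mulVg.
by rewrite mulgA mulgV mul1g mulg1.
Qed.

End Homomorphisms.

Section Epimorphisms.
Variables (G H : profiniteGroupType) (f : G -> H).
Hypothesis ef : epimorphism f.

Lemma epi_hom : homomorphism f. Proof. by case: ef. Qed.
Lemma epi_onto y : exists x, f x = y.
Proof. by case: ef => _ /(_ y I)[x _ <-]; exists x. Qed.

Lemma image_cnormal (A : set G) : cnormal A -> cnormal (f @` A).
Proof.
move=> [cA sA nA]; split; [exact: image_closed epi_hom _ cA|exact: image_subgroup epi_hom _ sA|].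
move=> _ y [x Ax <-]; have [z <-] := epi_onto y; exists (x ^ z); first exact: nA.
by rewrite /conjg !(hom_mul epi_hom) (hom_inv epi_hom).
Qed.

Lemma image_onormal (A : set G) : onormal A -> onormal (f @` A).
Proof.
move=> oA; have [cA sA nA] := onormal_cnormal oA.
have [? ? ?] := image_cnormal (And3 cA sA nA); split=> //.
have [cK sK nK] := ker_cnormal epi_hom.
have -> : f @` A = ~` (f @` (~` (A *s ker f))).
  apply/seteqP; split=> [_ [x Ax <-] [y nAy /esym/(ker_eq epi_hom) Kxy]|y ny].
    by apply: nAy; exists x => //; exists (x^-1 * y); rewrite // mulgA mulgV mul1g.
  have [x xy] := epi_onto y; have [[a Aa [k Kk akx]]|nx] := pselect ((A *s ker f) x).
    by exists a => //; rewrite -xy -akx (hom_mul epi_hom) Kk mulg1.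
  by exfalso; apply: ny; exists x.
apply: closed_openC; apply: (image_closed epi_hom); apply: open_closedC.
by case: oA => oA _ _; exact: open_prodset.
Qed.

End Epimorphisms.

Lemma epi_comp (G H K : profiniteGroupType) (f : G -> H) (g : H -> K) :
  epimorphism f -> epimorphism g -> epimorphism (g \o f).
Proof.
move=> [hf sf] [hg sg]; split; first split.
- by split; [rewrite /= (hom_one hf) (hom_one hg)|move=> x y; rewrite /= (hom_mul hf) (hom_mul hg)].
- by move=> x; apply: continuous_comp; [exact: hf.2|exact: hg.2].
- by move=> z _; have [y _ <-] := sg z I; have [x _ <-] := sf y I; exists x.
Qed.

Lemma epi_id (G : profiniteGroupType) : epimorphism (@id G).
Proof. by split; [split=> // x; exact: cvg_id|move=> x _; exists x]. Qed.

(** By Goursat's lemma such a Gam is an isomorphism between a quotient of E and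
    a quotient of X.  A partial lift of a map to a further quotient of X then
    is a smaller set, and a limit of partial lifts is an intersection, with no
    quotient groups varying along the way. *)
Definition correspondence (E X : profiniteGroupType) (Gam : set (E * X)) :=
  [/\ closed Gam, is_subgroup Gam, forall e, exists x, Gam (e, x) &
      forall x, exists e, Gam (e, x)].

Lemma hausdorff_prod (T U : topologicalType) :
  hausdorff_space T -> hausdorff_space U -> hausdorff_space (T * U)%type.
Proof.
move=> hT hU [x u] [y v] cl; congr pair; [apply: hT|apply: hU] => A B nA nB.
  have [||[z w] [/= [Az _] [Bz _]]] := cl (A `*` setT) (B `*` setT); last by exists z.
    by exists (A, setT) => //; split => //; exact: filterT.
  by exists (B, setT) => //; split => //; exact: filterT.
have [||[z w] [/= [_ Az] [_ Bz]]] := cl (setT `*` A) (setT `*` B); last by exists w.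
  by exists (setT, A) => //; split => //; exact: filterT.
by exists (setT, B) => //; split => //; exact: filterT.
Qed.

Lemma compact_image_closed (E X Y : profiniteGroupType) (f : E -> X * Y) (A : set E) :
  continuous f -> closed A -> closed (f @` A).
Proof.
move=> cf cA; apply: compact_closed.
  by apply: hausdorff_prod; exact: profinite_hausdorff.
apply: continuous_compact; last exact: closed_compact.
exact: continuous_subspaceT.
Qed.

Lemma proj1_closed (E X : profiniteGroupType) (A : set (E * X)) :
  closed A -> closed (fst @` A).
Proof.
move=> cA; apply: compact_closed; first exact: profinite_hausdorff.
apply: continuous_compact; first by apply: continuous_subspaceT => x; exact: cvg_fst.
apply: (subclosed_compact cA (B := setT)) => //.
by rewrite -setXTT; apply: compact_setX; exact: compactG.
Qed.

Lemma proj2_closed (E X : profiniteGroupType) (A : set (E * X)) :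
  closed A -> closed (snd @` A).
Proof.
move=> cA; apply: compact_closed; first exact: profinite_hausdorff.
apply: continuous_compact; first by apply: continuous_subspaceT => x; exact: cvg_snd.
apply: (subclosed_compact cA (B := setT)) => //.
by rewrite -setXTT; apply: compact_setX; exact: compactG.
Qed.

(** Single-valuedness is a statement about the fibre over 1; continuity is the
    closed graph theorem for compact spaces: the preimage of a closed set is
    the projection of a closed, hence compact, part of Gam. *)
Lemma correspondence_epi (E X Y : profiniteGroupType) (Gam : set (E * X)) (a : X -> Y) :
  correspondence Gam -> epimorphism a -> (forall x, Gam (1, x) -> a x = 1) ->
  exists2 h : E -> Y, epimorphism h & forall e x, Gam (e, x) -> h e = a x.
Proof.
move=> [cG sG tE tX] ea G1.
have ha := epi_hom ea.
have uniq e x y : Gam (e, x) -> Gam (e, y) -> a x = a y.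
  move=> Gx Gy; apply/(ker_eq ha); apply: G1.
  have -> : (1, x^-1 * y) = (e, x)^-1 * (e, y) :> E * X by congr pair; rewrite mulVg.
  exact: (mem_mul sG (mem_inv sG Gx) Gy).
have [s Gs] := choice tE.
have hE e x : Gam (e, x) -> a (s e) = a x by move=> Gx; exact: uniq (Gs e) Gx.
exists (a \o s) => //; split; first split; first split.
- exact/G1/Gs.
- move=> x y /=; rewrite -(hom_mul ha); apply: hE; exact: (mem_mul sG (Gs x) (Gs y)).
- apply/continuous_closedP => A cA.
  have -> : (a \o s) @^-1` A = fst @` (Gam `&` (snd @^-1` (a @^-1` A))).
    apply/seteqP; split=> [e Ae|_ [[e x] [/= Gx Ax] <-]].
      by exists (e, s e) => //; split => //=.
    by rewrite /preimage/= (hE _ _ Gx).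
  apply: proj1_closed; apply: closedI => //.
  apply: (continuous_closedP _).1 (hom_preimage_closed ha cA).
  by move=> x; exact: cvg_snd.
- by move=> y _; have [x <-] := epi_onto ea y; have [e /hE] := tX x; exists e.
Qed.

Lemma closed_eqfun (T : topologicalType) (G : profiniteGroupType) (u v : T -> G) :
  continuous u -> continuous v -> closed [set t | u t = v t].
Proof.
move=> cu cv.
have -> : [set t | u t = v t] = (fun t => u t * (v t)^-1) @^-1` [set 1].
  apply/seteqP; split=> [t /= ->|t /= /divg1_eq//]; first by rewrite mulgV.
apply: (continuous_closedP _).1; last by case: (cnormal1 G).
move=> t; apply: (@continuous_comp _ _ _ (fun t => (u t, (v t)^-1)) (fun p : G * G => p.1 * p.2));
  last exact: mulg_continuous.
apply: cvg_pair => /=; first exact: cu.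
by apply: continuous_comp; [exact: cv|exact: invg_continuous].
Qed.

Lemma factor_epi (X Y Z : profiniteGroupType) (f : X -> Y) (g : X -> Z) :
  epimorphism f -> epimorphism g -> ker f `<=` ker g ->
  exists2 h : Y -> Z, epimorphism h & forall x, h (f x) = g x.
Proof.
move=> ef eg fg; have hf := epi_hom ef.
have [|//|h eh hE] := @correspondence_epi Y X Z (fun p => p.1 = f p.2) g _ eg.
- split.
  + apply: closed_eqfun => x; first exact: cvg_fst.
    by apply: continuous_comp; [exact: cvg_snd|exact: hf.2].
  + split; first by rewrite /= (hom_one hf).
    by move=> [y x] [z w] /= -> ->; rewrite (hom_mul hf) (hom_inv hf).
  + by move=> y; have [x <-] := epi_onto ef y; exists x.
  + by move=> x; exists (f x).
- by move=> x /= /esym/fg.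
- by exists h => // x; exact: hE.
Qed.

Lemma quotient_pi_epi (X : profiniteGroupType) (N : closedNormal X) :
  epimorphism (fun x => (\pi_(quotientGroup N) x)%qT) /\
  ker (fun x => (\pi_(quotientGroup N) x)%qT) = N.
Proof.
have hp : homomorphism (fun x => (\pi_(quotientGroup N) x)%qT).
  split; last exact: pi_quotient_continuous.
  by split=> // x y; symmetry; exact: quotient_mulE.
split.
  by split=> // a _; elim/quotient_ind: a => x; exists x.
apply/seteqP; split=> x.
  rewrite /ker/= -(hom_one hp) => /esym/pi_quotientP /=.
  by rewrite invg1 mul1g.
move=> Dx; rewrite /ker/= -(hom_one hp); apply/esym/pi_quotientP.
by rewrite invg1 mul1g.
Qed.

Lemma quotient_epi (X : profiniteGroupType) (D : set X) : cnormal D ->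
  exists (Q : profiniteGroupType) (p : X -> Q), epimorphism p /\ ker p = D.
Proof.
move=> [cD sD nD]; pose N := ClosedNormal cD sD nD.
by exists (quotientGroup N), (fun x => (\pi_(quotientGroup N) x)%qT); exact: quotient_pi_epi.
Qed.

Lemma inj_isomorphism (G H : profiniteGroupType) (f : G -> H) :
  epimorphism f -> ker f `<=` [set 1] -> isomorphism f.
Proof.
move=> ef f1; have [h eh hE] := factor_epi ef (epi_id G) f1.
split; first exact: epi_hom.
exists h; split=> //; first exact: epi_hom.
by move=> y; have [x <-] := epi_onto ef y; rewrite hE.
Qed.

Lemma isomorphism_ker (G H : profiniteGroupType) (f : G -> H) x :
  isomorphism f -> f x = 1 -> x = 1.
Proof.
move=> [hf [g [hg fK _]]] fx; rewrite -(fK x) fx; exact: hom_one.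
Qed.

Lemma open_ker_finite (X Q : profiniteGroupType) (p : X -> Q) :
  epimorphism p -> open (ker p) <-> finite_set [set: Q].
Proof.
move=> ep; split=> [oK|fQ].
  apply: compact_discrete_finite; first exact: compactG.
  move=> y; have [x <-] := epi_onto ep y.
  have o1 : onormal (p @` ker p).
    by apply: image_onormal => //; have [_ sK nK] := ker_cnormal (epi_hom ep).
  have [o1' _ _] := o1.
  have -> : [set p x] = [set z | (p @` ker p) ((p x)^-1 * z)].
    apply/seteqP; split=> [z ->|z [k -> /esym e1]] /=.
      by exists 1; [exact: (hom_one (epi_hom ep))|rewrite mulVg (hom_one (epi_hom ep))].
    by have /mulg1_eq := e1; rewrite invgK.
  exact: shift_open.
apply: (hom_preimage_open (epi_hom ep)); rewrite -[[set 1]]setCK; apply: closed_openC.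
apply: (accessible_finite_set_closed.1 (hausdorff_accessible (@profinite_hausdorff Q))).
exact: sub_finite_set fQ.
Qed.

Lemma quotient_finite (Q A : profiniteGroupType) :
  finite_set [set: Q] -> quotient_of Q A -> finite_set [set: A].
Proof.
move=> fQ [f [_ sf]].
have -> : [set: A] = f @` setT.
  by apply/seteqP; split=> // y _; have [x _ <-] := sf y I; exists x.
exact: finite_image.
Qed.

(** * Compact squares and atomic covers *)

Section CompactOver.
Variable X : profiniteGroupType.
Implicit Types (D K M N R : set X).

(** For R = ker (X -> P), the compactness of the square formed by X / (N & R),
    X / N, P and X / NR, read on the subgroups of X.  That square is cartesian
    for all normal R and N. *)
Definition compact_over R N := forall K, csubgroup K -> N `&` R `<=` K ->
  K *s R = setT -> K *s N = setT -> K = setT.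

(** The finite quotient X / N is covered by one that is attached to P by a
    compact square. *)
Definition isolated R N :=
  exists N', [/\ onormal N', N' `<=` N & compact_over R N'].

(** All finite quotients of X / D are isolated over X / R; for D = 1 this is a
    property of the cover X -> X / R. *)
Definition atomic R D := forall N, onormal N -> D `<=` N -> isolated R N.

(** By the modular law, N & N'R equals N'(N & R), so it inherits from N' the
    compactness over R; and it has the same trace on R as N. *)
Lemma isolated_above R N : cnormal R -> onormal N -> isolated R N ->
  exists N', [/\ onormal N', N' `<=` N, N' `&` R = N `&` R & compact_over R N'].
Proof.
move=> cR oN [M [oM MN cRM]].
have [_ sR nR] := cR; have [_ sM nM] := oM; have [_ sN nN] := oN.
have e : N `&` (M *s R) `&` R = N `&` R.
  apply/seteqP; split=> x; first by case=> -[].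
  by move=> [Nx Rx]; split=> //; split=> //; exact: prodset_subr.
exists (N `&` (M *s R)); split=> //; first by apply: onormalI => //; exact: onormalM.
rewrite /compact_over e => K cK RK KR KN; have [_ sK] := cK.
apply: cRM => //; first by move=> x [/MN ? ?]; exact: RK.
apply: prodset_fullP => x.
have [k [y [Kk [Ny [m Mm [r Rr mr]]] ->]]] := prodset_full x KN.
have Kr : K r.
  by apply: RK; split=> //; apply: (mem_mulIl sN (MN _ Mm)); rewrite mr.
exists (k * r); split; first exact: mem_mul.
rewrite -mr; have -> : (k * r)^-1 * (k * (m * r)) = r^-1 * m * r.
  by rewrite invgM !mulgA mulgVK.
exact: mem_conjV.
Qed.

(** Transitivity of compactness.  With L compact over R and K a competitor for
    M & L, compactness of L gives K(L & R) = X.  Choosing L inside (N & M)D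
    yields L & R = (M & L & R)D, so KD = X, and compactness of M over D
    applies to K. *)
Lemma atomic_step R D M : cnormal R -> cnormal D -> D `<=` R ->
  atomic R D -> onormal M -> compact_over D M -> atomic R (D `&` M).
Proof.
move=> cR cD DR aD oM cDM N oN DMN.
have [_ sR nR] := cR; have [_ sD nD] := cD; have [_ sM nM] := oM; have [_ sN nN] := oN.
have sNM := subgroupI sN sM.
have oN1 : onormal ((N `&` M) *s D) by apply: onormalM => //; exact: onormalI.
have DN1 : D `<=` (N `&` M) *s D by exact: prodset_subr.
have [L [oL LN1 LR cRL]] := isolated_above cR oN1 (aD _ oN1 DN1).
have [_ sL nL] := oL.
have DL : D `<=` L.
  by move=> d Dd; have : (L `&` R) d by [rewrite LR; split; [exact: DN1|exact: DR]]; case.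
exists (M `&` L); split; first exact: onormalI.
  move=> x [Mx /LN1[y [Ny My] [d Dd yd]]]; rewrite -yd; apply: mem_mul => //; apply: DMN.
  by split=> //; apply: (mem_mulIl sM My); rewrite yd.
move=> K cK RK KR KML; have [_ sK] := cK.
have KLR : K *s (L `&` R) = setT.
  apply: cRL.
  - by apply: csubgroupM => //; apply: cnormalI => //; exact: onormal_cnormal.
  - exact: prodset_subr.
  - by apply: prodset_fullS KR => //; apply: prodset_subl; exact: subgroupI.
  - apply: prodset_fullS KML; last by move=> x [].
    by apply: prodset_subl; exact: subgroupI.
apply: cDM => //.
- by move=> x [Mx Dx]; apply: RK; split; [split=> //; exact: DL|exact: DR].
- apply: prodset_fullP => x; have [k [n [Kk [Ln Rn] ->]]] := prodset_full x KLR.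
  have [y [Ny My] [d Dd yd]] := LN1 _ Ln.
  exists (k * y); split; last by rewrite -yd invgM !mulgA mulgVK mulVg mul1g.
  apply: mem_mul => //; apply: RK; split; first split=> //.
    by apply: (mem_mulIr sL (DL _ Dd)); rewrite yd.
  by apply: (mem_mulIr sR (DR _ Dd)); rewrite yd.
- by apply: prodset_fullS KML => // x [].
Qed.

(** The covers X / (D & M) -> X / D that the construction below adds: they are
    cartesian and compact over a finite quotient.  The two maps f and g say that the finite group X / M is isomorphic to some quotient of X / D,
    not that M contains D. *)
Definition step D M := [/\ onormal M, compact_over D M &
  exists (B : profiniteGroupType) (f g : X -> B),
    [/\ epimorphism f, epimorphism g, ker f = M & D `<=` ker g]].

End CompactOver.

Section EmbeddingQuotient.
Variables (X Q : profiniteGroupType) (D : set X) (p : X -> Q).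
Hypotheses (eX : embedding_property X) (ep : epimorphism p) (kp : ker p = D).
Hypothesis no_step : forall M, step D M -> D `<=` M.

(** Lift the embedding problem Q -> A, B -> A to gam : X -> B, with kernel M.
    If M does not contain D then the square of D and M is not compact, as
    there is no proper step.  A subgroup K showing this lets Q -> A be lifted
    to an intermediate quotient C of B with C -> A not injective, so the kernel of
    B -> C is smaller than that of B -> A and induction applies. *)
Lemma no_step_embedding : embedding_property Q.
Proof.
have hp := epi_hom ep; have cD : cnormal D by rewrite -kp; exact: ker_cnormal.
have [clD sD nD] := cD.
move=> A B alpha phi fA qA fB [q eq].
have [n] := ubnP #|` fset_set (ker alpha)|.
elim: n A alpha phi fA qA => // n IH A alpha phi fA qA lt_n ea ephi.
have ha := epi_hom ea.
have eqX : epimorphism (q \o p) := epi_comp ep eq.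
have ephiX : epimorphism (phi \o p) := epi_comp ep ephi.
have [gam eg gamE] : exists2 gam : X -> B, epimorphism gam & alpha \o gam = phi \o p.
  by apply: eX => //; [exists (phi \o p)|exists (q \o p)].
have gamE' x : alpha (gam x) = phi (p x) by exact: (congr1 (fun f => f x) gamE).
have hg := epi_hom eg.
pose M := ker gam.
have oM : onormal M.
  have [_ ? ?] := ker_cnormal hg.
  by split=> //; apply/(open_ker_finite eg).
have [_ sM nM] := oM.
have phiD x : D x -> phi (p x) = 1.
  by rewrite -kp => px; rewrite px (hom_one (epi_hom ephi)).
have [DM|nDM] := pselect (D `<=` M).
  have [|h eh hE] := factor_epi ep eg; first by rewrite kp.
  exists h => //; apply/funext => y; have [x <-] := epi_onto ep y.
  by rewrite /= hE gamE'.
have [K [cK DMK KD KM nK]] : exists K, [/\ csubgroup K, M `&` D `<=` K, K *s D = setT,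
    K *s M = setT & K <> setT].
  apply: contrapT => nK; apply: nDM; apply: no_step; split=> //; last first.
    exists B, gam, (q \o p); split=> //.
    by rewrite -kp => x px; rewrite /ker/= px (hom_one (epi_hom eq)).
  move=> K cK MDK KD KM; apply: contrapT => nKT; apply: nK.
  by exists K; split.
have [clK sK] := cK.
have nKD : is_normal (K `&` D) by exact: supplement_normal sK sD nD sM nM DMK KM.
have cM1 : cnormal ((K `&` D) *s M).
  apply: cnormalM; last exact: onormal_cnormal.
  by split=> //; [exact: closedI|exact: subgroupI].
have [C [c [ec kc]]] := quotient_epi cM1; have hc := epi_hom ec.
have [|alpha1 ea1 alpha1E] := factor_epi eg ec.
  by rewrite kc; apply: prodset_subr; exact: subgroupI.
have [|alpha2 ea2 alpha2E] := factor_epi ec ephiX.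
  rewrite kc; apply: prodset_sub.
  - by have [] := ker_cnormal (epi_hom ephiX).
  - by move=> x [_ Dx]; exact: phiD.
  - by move=> x Mx; rewrite /ker/= -gamE' Mx (hom_one ha).
have alphaE b : alpha b = alpha2 (alpha1 b).
  by have [x <-] := epi_onto eg b; rewrite alpha1E alpha2E gamE'.
have fC : finite_set [set: C] by apply: quotient_finite fB _; exists alpha1.
(* Modulo D on one side and M on the other, K is the graph of a map from
   X / D onto C. *)
have [||phi1 ephi1 phi1E] := @correspondence_epi Q C C
  ((fun x => (p x, c x)) @` K) id _ (epi_id C).
- split.
  + apply: compact_image_closed => //.
    by move=> x; apply: cvg_pair => /=; [exact: hp.2|exact: hc.2].
  + split; first by exists 1; [exact: mem_one|rewrite (hom_one hp) (hom_one hc)].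
    move=> _ _ [x Kx <-] [y Ky <-]; exists (x / y); first exact: sK.2.
    by rewrite (hom_mul hp) (hom_mul hc) (hom_inv hp) (hom_inv hc).
  + move=> y; have [x <-] := epi_onto ep y.
    have [k [d [Kk Dd ->]]] := prodset_full x KD; exists (c k), k => //.
    by congr pair; rewrite (hom_mul hp) [p d](_ : _ = 1) ?mulg1//; rewrite -kp in Dd.
  + move=> y; have [x <-] := epi_onto ec y.
    have [k [m [Kk Mm ->]]] := prodset_full x KM; exists (p k), k => //.
    congr pair; rewrite (hom_mul hc) [c m](_ : _ = 1) ?mulg1//.
    by have : ker c m by [rewrite kc; apply: prodset_subr => //; exact: subgroupI].
- move=> y [x Kx [px cx]]; rewrite -cx; have : ker c x; last by [].
  by rewrite kc; apply: prodset_subl => //; split=> //; rewrite -kp.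
have phi1K x : K x -> phi1 (p x) = c x by move=> Kx; apply: phi1E; exists x.
have phiE y : alpha2 (phi1 y) = phi y.
  have [x <-] := epi_onto ep y; have [k [d [Kk Dd ->]]] := prodset_full x KD.
  rewrite (hom_mul hp) [p d](_ : _ = 1) ?mulg1; last by rewrite -kp in Dd.
  by rewrite phi1K // alpha2E.
have [||||g2 eg2 g2E] := IH C alpha1 phi1 fC => //; first by exists phi1.
  rewrite -ltnS; apply: leq_trans lt_n; rewrite ltnS; apply: fproper_ltn_card.
  have fin (U : set B) : finite_set U by apply: sub_finite_set fB.
  rewrite fproperE; apply/andP; split; first apply/fsubsetP => b.
    by rewrite !in_fset_set// !inE /ker/= alphaE => ->; rewrite (hom_one (epi_hom ea2)).
  (* The image in B of an element of D outside K separates the two kernels. *)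
  have [d [Dd nKd]] : exists d, D d /\ ~ K d.
    apply: contrapT => nd; apply: nK; apply/seteqP; split=> // x _.
    have [k [d [Kk Dd ->]]] := prodset_full x KD; apply: mem_mul => //.
    by apply: contrapT => nKd; apply: nd; exists d.
  apply/negP => /fsubsetP/(_ (gam d)); rewrite !in_fset_set// !inE /ker/=.
  rewrite alpha1E gamE' phiD // => /(_ erefl) cd.
  have : ker c d by [].
  rewrite kc => -[k [Kk Dk] [m Mm kmd]]; apply: nKd; rewrite -kmd.
  apply: mem_mul => //; apply: DMK; split=> //.
  by apply: (mem_mulIl sD Dk); rewrite kmd.
exists g2 => //; apply/funext => y /=; rewrite alphaE -phiE.
by congr alpha2; exact: (congr1 (fun f => f y) g2E).
Qed.

End EmbeddingQuotient.

(** * Lifting correspondences *)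

Definition fiber (E X : profiniteGroupType) (Gam : set (E * X)) : set X :=
  [set x | Gam (1, x)].

Section Correspondences.
Variables (E X : profiniteGroupType) (Gam : set (E * X)).
Hypothesis cG : correspondence Gam.

Lemma corr_mul e e' x x' : Gam (e, x) -> Gam (e', x') -> Gam (e * e', x * x').
Proof. by move=> Gx Gy; case: cG => _ sG _ _; exact: (mem_mul sG Gx Gy). Qed.

Lemma corr_inv e x : Gam (e, x) -> Gam (e^-1, x^-1).
Proof. by move=> Gx; case: cG => _ sG _ _; exact: (mem_inv sG Gx). Qed.

Lemma corr_fiber_mul e x d : Gam (e, x) -> fiber Gam d -> Gam (e, x * d).
Proof. by move=> /corr_mul h /h; rewrite mulg1. Qed.

Lemma corr_fiber e x y : Gam (e, x) -> Gam (e, y) -> fiber Gam (x^-1 * y).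
Proof. by move=> /corr_inv/corr_mul h /h; rewrite mulVg. Qed.

Lemma fiber_cnormal : cnormal (fiber Gam).
Proof.
have [clG sG tE tX] := cG; split.
- apply: (continuous_closedP _).1 clG => x.
  by apply: cvg_pair => /=; [exact: cvg_cst|exact: cvg_id].
- split; first exact: (mem_one sG).
  by move=> x y Gx Gy; have := corr_mul Gx (corr_inv Gy); rewrite /fiber/= mulgV.
- move=> x y Gx; have [e Ge] := tX y.
  have := corr_mul (corr_inv Ge) (corr_mul Gx Ge).
  by rewrite mul1g mulVg.
Qed.

(** One lifting step: the embedding property of E provides a map onto the
    finite quotient X / M, and compactness of the square makes the resulting
    map onto the fibre product surjective. *)
Lemma step_lift M : embedding_property E -> step (fiber Gam) M ->
  exists Gam', [/\ correspondence Gam', Gam' `<=` Gam &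
    fiber Gam' = fiber Gam `&` M].
Proof.
move=> eE [oM cDM [B [f [g [ef eg kf Dg]]]]].
have [clG sG tE tX] := cG; have cD := fiber_cnormal.
have [_ sD nD] := cD; have [_ sM nM] := oM.
have hf := epi_hom ef.
have [A [a [ea ka]]] := quotient_epi (cnormalM (onormal_cnormal oM) cD).
have ha := epi_hom ea.
have [|alpha ealpha alphaE] := factor_epi ef ea.
  by rewrite kf ka; exact: prodset_subl.
have [|phi ephi phiE] := correspondence_epi cG ea.
  move=> x Gx; have : ker a x; last by [].
  by rewrite ka; exact: prodset_subr.
have [|g' eg' _] := correspondence_epi cG eg; first by move=> x /Dg.
have fB : finite_set [set: B].
  by apply/(open_ker_finite ef); rewrite kf; case: oM.
have fA : finite_set [set: A] by apply: quotient_finite fB _; exists alpha.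
have [gam egam gamE] : exists2 gam : E -> B, epimorphism gam & alpha \o gam = phi.
  by apply: eE => //; [exists phi|exists g'].
have hgam := epi_hom egam.
have gamE' e : alpha (gam e) = phi e by exact: (congr1 (fun u => u e) gamE).
pose Gam' := Gam `&` [set p | gam p.1 = f p.2].
have clG' : closed Gam'.
  apply: closedI => //; apply: closed_eqfun => p.
    by apply: continuous_comp; [exact: cvg_fst|exact: hgam.2].
  by apply: continuous_comp; [exact: cvg_snd|exact: hf.2].
have sG' : is_subgroup Gam'.
  apply: subgroupI => //; split=> /=; first by rewrite (hom_one hf) (hom_one hgam).
  move=> [e x] [e' x'] /= ex ex'.
  by rewrite (hom_mul hf) (hom_mul hgam) (hom_inv hf) (hom_inv hgam) ex ex'.
have tE' e : exists x, Gam' (e, x).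
  have [x1 G1] := tE e; have [x0 fx0] := epi_onto ef (gam e).
  have : ker a (x0^-1 * x1).
    by apply/(ker_eq ha); rewrite -alphaE fx0 gamE' (phiE _ _ G1).
  rewrite ka => -[m Mm [d Dd md]]; exists (x1 * d^-1); split.
    by apply: corr_fiber_mul => //; exact: mem_inv.
  have -> : x1 * d^-1 = x0 * m.
    by apply: (mulIg d); rewrite mulgVK -mulgA md mulgA mulgV mul1g.
  rewrite /= (hom_mul hf) fx0 [f m](_ : _ = 1) ?mulg1//.
  by have : ker f m by rewrite kf.
have fib : fiber Gam' = fiber Gam `&` M.
  rewrite -kf; apply/seteqP; split=> x [Gx /= fx]; split=> //=.
    by rewrite /ker/= -fx (hom_one hgam).
  by rewrite (hom_one hgam) fx.
exists Gam'; split=> //; last by move=> p [].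
split=> // x.
have KT : snd @` Gam' = setT.
  apply: cDM.
  - split; first exact: proj2_closed.
    split; first by exists (1, 1) => //; exact: (mem_one sG').
    move=> _ _ [[e y] Gy <-] [[e' y'] Gy' <-]; exists ((e, y) / (e', y')) => //.
    exact: sG'.2.
  - by move=> y [My Gy]; exists (1, y) => //; have : fiber Gam' y by rewrite fib.
  - apply: prodset_fullP => y; have [e Gy] := tX y; have [z Gz] := tE' e.
    exists z; split; first by exists (e, z).
    by apply: corr_fiber Gy; case: Gz.
  - apply: prodset_fullP => y; have [e ey] := epi_onto egam (f y).
    have [z [Gz /= fz]] := tE' e; exists z; split; first by exists (e, z).
    by rewrite -kf; apply/(ker_eq hf); rewrite -fz.
have : (snd @` Gam') x by rewrite KT.
by case=> -[e y] Gy /= <-; exists e.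
Qed.

End Correspondences.

Lemma bigcap_correspondence (E X : profiniteGroupType) (F : set (set (E * X))) :
  (forall Gam, F Gam -> correspondence Gam) -> F !=set0 -> total_on F subset ->
  correspondence (\bigcap_(Gam in F) Gam).
Proof.
move=> cF [G0 FG0] tF; have cEX : compact [set: E * X].
  by rewrite -setXTT; apply: compact_setX; exact: compactG.
have cl1 (T : profiniteGroupType) (t : T) : closed [set t].
  apply: accessible_closed_set1; apply: hausdorff_accessible; exact: profinite_hausdorff.
have inter (C : set (E * X)) : closed C -> (forall Gam, F Gam -> Gam `&` C !=set0) ->
    (\bigcap_(Gam in F) Gam) `&` C !=set0.
  move=> cC FC; apply/set0P/eqP => h.
  have [|||A FA AC] := chain_compact cEX _ _ tF (closed_openC cC).
  - by move=> Gam /cF[].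
  - by exists G0.
  - by move=> p Fp Cp; have : ((\bigcap_(Gam in F) Gam) `&` C) p by []; rewrite h.
  - by have [p [Ap Cp]] := FC _ FA; exact: AC Cp.
split.
- by apply: closed_bigI => Gam /cF[].
- split; first by move=> Gam /cF[_ [? _] _ _].
  by move=> p q Fp Fq Gam FG; have [_ [_ sG] _ _] := cF _ FG; apply: sG; [exact: Fp|exact: Fq].
- move=> e; have [||[e' x] [Fx /= ex]] := inter (fst @^-1` [set e]).
  + by apply: (continuous_closedP _).1 (@cl1 _ e) => p; exact: cvg_fst.
  + by move=> Gam /cF[_ _ /(_ e)[x Gx] _]; exists (e, x).
  + by exists x; rewrite -ex.
- move=> x; have [||[e x'] [Fx /= ex]] := inter (snd @^-1` [set x]).
  + by apply: (continuous_closedP _).1 (@cl1 _ x) => p; exact: cvg_snd.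
  + by move=> Gam /cF[_ _ _ /(_ x)[e Gx]]; exists (e, x).
  + by exists e; rewrite -ex.
Qed.

(** * Smallest embedding covers *)

Section Tower.
Variables (X P : profiniteGroupType) (rho : X -> P).
Hypotheses (erho : epimorphism rho) (eX : embedding_property X).
Implicit Types (D M : set X).

Let R := ker rho.
Let cR : cnormal R. Proof. exact: ker_cnormal (epi_hom erho). Qed.

(** A proper step D & M if there is one, and D otherwise: the default setT
    then leaves D unchanged. *)
Definition next D := D `&` xget setT [set M | step D M /\ ~ D `<=` M].

Lemma next_sub D : next D `<=` D. Proof. by move=> x []. Qed.

Lemma nextP D : next D = D \/ exists M, step D M /\ next D = D `&` M.
Proof.
rewrite /next; case: xgetP => [M _ [sDM _]|_]; first by right; exists M.
by left; rewrite setIT.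
Qed.

Lemma next_fix D M : next D = D -> step D M -> D `<=` M.
Proof.
rewrite /next; case: xgetP => [N _ [_ nDN] DN|nN _ sDM].
  by exfalso; apply: nDN; rewrite -DN => x [].
by apply: contrapT => nDM; apply: (nN M).
Qed.

(** The kernels reached from R by transfinite iteration of [next].  Closure
    under all nonempty intersections amounts to closure under limits, because
    the tower is a chain. *)
Inductive tower : set X -> Prop :=
| tower_ker : tower R
| tower_next D : tower D -> tower (next D)
| tower_bigcap (F : set (set X)) : F !=set0 -> (forall D, F D -> tower D) ->
    tower (\bigcap_(D in F) D).

Lemma tower_sub D : tower D -> D `<=` R.
Proof.
elim=> [//|E _ ER|F [E FE] _ IH]; first exact: subset_trans (@next_sub E) ER.
by move=> x Fx; apply: (IH _ FE); exact: Fx.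
Qed.

Lemma tower_cnormal D : tower D -> cnormal D.
Proof.
elim=> [//|E _ cE|F _ _ IH]; last exact: bigcap_cnormal.
case: (nextP E) => [->//|[M [[oM _ _] ->]]].
by apply: cnormalI => //; exact: onormal_cnormal.
Qed.

(** The notion on which the Bourbaki-Witt argument rests: every member of the
    tower is extreme, so the tower is a chain. *)
Let extreme C := forall D, tower D -> C `<=` D -> C <> D -> C `<=` next D.

Lemma extreme_compare C : tower C -> extreme C ->
  forall D, tower D -> C `<=` D \/ D `<=` next C.
Proof.
move=> tC xC D; elim=> [|E tE [CE|EC]|F F0 _ IH].
- by left; exact: tower_sub.
- have [CE'|nCE] := pselect (C = E); first by right; rewrite CE'.
  by left; exact: xC.
- by right; apply: subset_trans EC; exact: next_sub.
- have [all|nall] := pselect (forall A, F A -> C `<=` A).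
    by left=> x Cx A FA; exact: all.
  right=> x Fx; apply: contrapT => nx; apply: nall => A FA.
  by case: (IH _ FA) => // h; exfalso; apply: nx; apply: h; exact: Fx.
Qed.

Lemma tower_extreme C : tower C -> extreme C.
Proof.
elim=> [|E tE xE|F F0 tF IH] D tD CD nCD.
- by exfalso; apply: nCD; apply/seteqP; split=> //; exact: tower_sub.
- have [ED|DE] := extreme_compare tE xE tD; last first.
    by exfalso; apply: nCD; apply/seteqP; split.
  have [->|nED] := pselect (E = D); first by [].
  by apply: subset_trans (xE _ tD ED nED); exact: next_sub.
- have [A FA nDA] : exists2 A, F A & ~ D `<=` A.
    apply: contrapT => nA; apply: nCD; apply/seteqP; split=> // x Dx A FA.
    by apply: contrapT => nAx; apply: nA; exists A => // /(_ _ Dx).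
  have [AD|DA] := extreme_compare (tF _ FA) (IH _ FA) tD; last first.
    by exfalso; apply: nDA; apply: subset_trans DA _; exact: next_sub.
  apply: (@subset_trans _ A); first by move=> x; exact.
  by apply: (IH _ FA) => // ADe; apply: nDA; rewrite ADe.
Qed.

Lemma tower_total : total_on tower subset.
Proof.
move=> C D tC tD; have [|DC] := extreme_compare tC (tower_extreme tC) tD; first by left.
by right; apply: subset_trans DC _; exact: next_sub.
Qed.

(** A fixed point of [next] is thus the bottom of the tower; this is what
    identifies the place where a lift can no longer be extended. *)
Lemma tower_fix C D : tower C -> next C = C -> tower D -> C `<=` D.
Proof.
move=> tC nC tD; have [//|DC] := extreme_compare tC (tower_extreme tC) tD.
move: tD DC; elim=> [|E tE IH|F F0 tF IH] DC.
- exact: tower_sub.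
- have [CE|EC] := extreme_compare tC (tower_extreme tC) tE.
    have [<-|nCE] := pselect (C = E); first by rewrite nC.
    exact: (tower_extreme tC).
  have EC' : E = C by apply/seteqP; split; [move: EC; rewrite nC|exact: IH].
  by rewrite EC' nC.
- move=> x Cx A FA.
  by case: (extreme_compare tC (tower_extreme tC) (tF _ FA)) => [|/(IH _ FA)]; exact.
Qed.

Definition bottom := \bigcap_(D in tower) D.

Lemma tower_bottom : tower bottom.
Proof. by apply: tower_bigcap => //; exists R; exact: tower_ker. Qed.

Lemma next_bottom : next bottom = bottom.
Proof.
apply/seteqP; split; first exact: next_sub.
by move=> x; apply; apply: tower_next; exact: tower_bottom.
Qed.

Lemma tower_atomic D : tower D -> atomic R D.
Proof.
elim=> [|E tE aE|F [C FC] tF IH] N oN DN.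
- exists N; split=> // K cK RK KR KN; have [_ sK] := cK.
  apply/seteqP; split=> // x _; have [k [r [Kk Rr ->]]] := prodset_full x KR.
  by apply: mem_mul => //; apply: RK; split=> //; exact: DN.
- move: DN; case: (nextP E) => [->|[M [[oM cEM _] ->]]] DN; first exact: aE.
  by apply: (atomic_step cR _ _ aE oM cEM oN DN); [exact: tower_cnormal|exact: tower_sub].
- have [||||A FA] := chain_compact (@compactG X) _ _ _ _ DN.
  + by move=> A /tF/tower_cnormal[].
  + by exists C.
  + by move=> A B FA FB; apply: tower_total; exact: tF.
  + by case: oN.
  + exact: IH.
Qed.

(** By Zorn's lemma there is a minimal correspondence over P with fibre in the
    tower.  A proper step at its fibre could be lifted by the embedding
    property of E, so the fibre is the bottom. *)
Lemma tower_lift (E : profiniteGroupType) (eps : E -> P) : embedding_cover eps ->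
  exists Gam : set (E * X), [/\ correspondence Gam, fiber Gam = bottom &
    forall e x, Gam (e, x) -> eps e = rho x].
Proof.
move=> [eeps eE].
pose good Gam := [/\ correspondence Gam, tower (fiber Gam) &
    forall e x, Gam (e, x) -> eps e = rho x].
have good0 : good [set p : E * X | eps p.1 = rho p.2].
  have he := epi_hom eeps; have hr := epi_hom erho.
  split=> //; last first.
    have -> : fiber [set p : E * X | eps p.1 = rho p.2] = R; last exact: tower_ker.
    by apply/seteqP; split=> x; rewrite /fiber/R/ker/= (hom_one he).
  split.
  - apply: closed_eqfun => p.
      by apply: continuous_comp; [exact: cvg_fst|exact: he.2].
    by apply: continuous_comp; [exact: cvg_snd|exact: hr.2].
  - split=> /=; first by rewrite (hom_one he) (hom_one hr).
    move=> [e x] [e' x'] /= ex ex'.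
    by rewrite !(hom_mul he, hom_mul hr, hom_inv he, hom_inv hr) ex ex'.
  - by move=> e; have [x ex] := epi_onto erho (eps e); exists x; rewrite /= ex.
  - by move=> x; have [e ex] := epi_onto eeps (rho x); exists e.
have [|Gam [[cG tG epsG] _ minG]] := Zorn_bigcap good0.
  move=> F Fgood F0 tF; split.
  - by apply: bigcap_correspondence => // Gam /Fgood[].
  - have -> : fiber (\bigcap_(Gam in F) Gam) = \bigcap_(D in @fiber E X @` F) D.
      apply/seteqP; split=> [x Fx _ [Gam FG <-]|x Fx Gam FG]; first exact: Fx.
      by apply: (Fx (fiber Gam)); exists Gam.
    apply: tower_bigcap; first by have [Gam FG] := F0; exists (fiber Gam), Gam.
    by move=> _ [Gam /Fgood[_ ? _] <-].
  - by have [Gam FG] := F0; move=> e x /(_ _ FG); have [_ _] := Fgood _ FG; apply.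
exists Gam; split=> //.
have nG : next (fiber Gam) = fiber Gam.
  case: (nextP (fiber Gam)) => // -[M [sM nM]].
  have [Gam' [cG' GG fG']] := step_lift cG eE sM.
  rewrite nM -fG'; congr fiber; apply: minG => //; split=> //.
    by rewrite fG' -nM; exact: tower_next.
  by move=> e x /GG; exact: epsG.
apply/seteqP; split; first exact: tower_fix tower_bottom.
by move=> x; exact.
Qed.

(** At the bottom of the tower no step is left, which gives the embedding
    property, and every embedding cover of P lifts down to it. *)
Lemma smallest_cover_exists : exists (Q : profiniteGroupType) (p : X -> Q) (eps : Q -> P),
  [/\ epimorphism p, eps \o p = rho, smallest_embedding_cover eps & atomic R (ker p)].
Proof.
have [Q [p [ep kp]]] := quotient_epi (tower_cnormal tower_bottom).
have [|eps eeps epsE] := factor_epi ep erho.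
  by rewrite kp; exact: tower_sub tower_bottom.
exists Q, p, eps; split=> //; first by apply/funext.
  split; split=> //.
    by apply: (no_step_embedding eX ep kp) => M; exact: next_fix next_bottom.
  move=> E eps' cE; have [Gam [cG fG GE]] := tower_lift cE.
  have [|h eh hE] := correspondence_epi cG ep.
    by move=> x Gx; have : fiber Gam x by []; rewrite fG -kp.
  exists h => //; apply/funext => e /=.
  have [_ _ /(_ e)[x Gx] _] := cG.
  by rewrite (hE _ _ Gx) epsE (GE _ _ Gx).
by rewrite kp; exact: tower_atomic tower_bottom.
Qed.

End Tower.

(** * The fundament *)

(** For R = ker (X -> P), the N such that X / N -> P is indecomposable. *)
Definition maximal_below (X : profiniteGroupType) (R N : set X) :=
  [/\ cnormal N, N `<=` R, ~ R `<=` N &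
    forall Y, cnormal Y -> N `<=` Y -> Y `<=` R -> Y `<=` N \/ R `<=` Y].

Section Fundament.
Variables (X P : profiniteGroupType) (rho : X -> P).
Hypothesis erho : epimorphism rho.
Implicit Types (K L N Y : set X).

Let R := ker rho.
Let S := Mker rho.
Let hrho := epi_hom erho.
Let cR : cnormal R. Proof. exact: ker_cnormal. Qed.

Lemma closedNormal_cnormal (N : closedNormal X) : cnormal N.
Proof. by case: N. Qed.

Lemma indecomposable_induced (N : closedNormal X) : N `<=` R ->
  indecomposable (@induced _ _ N rho) <-> maximal_below R N.
Proof.
move=> NR; have [epi kpi] := quotient_pi_epi N.
pose pi x : quotientGroup N := (\pi_(quotientGroup N) x)%qT.
have indE x : induced rho (pi x) = rho x by exact: inducedE.
have eind : epimorphism (@induced _ _ N rho).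
  have [|h eh hE] := factor_epi epi erho; first by rewrite kpi.
  suff -> : @induced _ _ N rho = h by [].
  by apply/funext => y; have [x <-] := epi_onto epi y; rewrite hE; exact: indE.
split=> [[_ niso dec]|[cN _ nRN maxN]].
  split=> //; first exact: closedNormal_cnormal.
    move=> RN; apply: niso; apply: inj_isomorphism => // y.
    have [x <-] := epi_onto epi y; rewrite /ker/= => xy.
    have /RN : R x by rewrite /R/ker/= -indE.
    by rewrite -kpi.
  move=> Y cY NY YR; have [Q [q [eq kq]]] := quotient_epi cY.
  have [|e1 ee1 e1E] := factor_epi epi eq; first by rewrite kpi kq.
  have [|e2 ee2 e2E] := factor_epi eq erho; first by rewrite kq.
  have [|iso1|iso2] := dec _ e1 e2 ee1 ee2.
  - apply/funext => y; have [x <-] := epi_onto epi y.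
    by rewrite /= e1E e2E; exact: indE.
  - left=> x; rewrite -kq => qx; rewrite -kpi /ker/=; apply: (isomorphism_ker iso1).
    by rewrite e1E.
  - right=> x Rx; rewrite -kq /ker/=; apply: (isomorphism_ker iso2).
    by rewrite e2E.
split=> //.
  move=> iso; apply: nRN => x Rx; rewrite -kpi; apply: (isomorphism_ker iso).
  by rewrite indE.
move=> Q e1 e2 ee1 ee2 e12.
have e12' x : e2 (e1 (pi x)) = rho x by rewrite -indE e12.
have [|||Yk|Yk] := maxN (ker (e1 \o pi)).
- exact: ker_cnormal (epi_hom (epi_comp epi ee1)).
- move=> x; rewrite -{1}kpi /ker/= => px.
  by rewrite /pi px (hom_one (epi_hom ee1)).
- move=> x ex; have {}ex : e1 (pi x) = 1 by exact: ex.
  by rewrite /R/ker/= -e12' ex (hom_one (epi_hom ee2)).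
- left; apply: inj_isomorphism => // y; have [x <-] := epi_onto epi y => /Yk.
  by rewrite -kpi.
- right; apply: inj_isomorphism => // y; have [y' <-] := epi_onto ee1 y.
  have [x <-] := epi_onto epi y'; rewrite /ker/= e12' => /Yk; exact.
Qed.

Lemma MkerP x : S x <-> R x /\ forall N, maximal_below R N -> N x.
Proof.
split=> [[Rx Sx]|[Rx Nx]]; split=> //.
  move=> N maxN; have [[cN sN nN] NR _ _] := maxN.
  by apply: (Sx (ClosedNormal cN sN nN)) => //; exact/indecomposable_induced.
by move=> N NR /(indecomposable_induced NR)/Nx.
Qed.

Lemma Mker_cnormal : cnormal S.
Proof.
have -> : S = R `&` \bigcap_(N in maximal_below R) N.
  apply/seteqP; split=> [x /MkerP[Rx Nx]|x [Rx Nx]]; first by split.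
  by apply/MkerP; split.
by apply: cnormalI => //; apply: bigcap_cnormal => N [].
Qed.

Lemma Mker_sub : S `<=` R. Proof. by move=> x []. Qed.

Lemma Mker_maximal N : maximal_below R N -> S `<=` N.
Proof. by move=> maxN x /MkerP[_]; apply. Qed.

(** R / S is residually simple, hence semisimple, as an X-group.  Concretely,
    take L minimal among the closed normal subgroups between S and R that are
    not inside V; this exists as V is open.  If L & V is not in S, some N
    maximal below R does not contain it, so R = (L & V)N and N & L is not
    inside V either.  Minimality then puts L inside N, a contradiction. *)
Lemma socle V : onormal V -> S `<=` V -> ~ R `<=` V ->
  exists L, [/\ cnormal L, L `<=` R, ~ L `<=` V & L `&` V `<=` S].
Proof.
move=> oV SV nRV; have [_ sV nV] := oV.
pose good L := [/\ cnormal L, S `<=` L, L `<=` R & ~ L `<=` V].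
have [||L [[cL SL LR nLV] _ minL]] := @Zorn_bigcap _ good R.
- by split=> //; exact: Mker_sub.
- move=> F Fg [A FA] tF; split.
  + by apply: bigcap_cnormal => B /Fg[].
  + by move=> x Sx B /Fg[_ SB _ _]; exact: SB.
  + by move=> x /(_ _ FA); have [_ _ AR _] := Fg _ FA; exact: AR.
  + move=> FV; have [|||B /Fg[_ _ _ nBV] BV] := chain_compact (@compactG X) _ _ tF _ FV => //.
    * by move=> B /Fg[[]].
    * by exists A.
    * by case: oV.
exists L; split=> // x [Lx Vx]; apply: contrapT => nSx.
have [N maxN nNx] : exists2 N, maximal_below R N & ~ N x.
  apply: contrapT => nN; apply: nSx; apply/MkerP; split; first exact: LR.
  by move=> N maxN; apply: contrapT => nNx; apply: nN; exists N.
have [cN NR _ maxN'] := maxN; have [_ sN _] := cN; have [_ sR _] := cR; have [_ sL _] := cL.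
have cLV : cnormal (L `&` V) by apply: cnormalI => //; exact: onormal_cnormal.
have [_ sLV _] := cLV.
have [|||h|RLVN] := maxN' ((L `&` V) *s N).
- exact: cnormalM.
- exact: prodset_subr.
- by apply: prodset_sub => // y [/LR].
- by apply: nNx; apply: h; apply: prodset_subl.
suff e : N `&` L = L by have : (N `&` L) x by [rewrite e]; case=> /nNx.
apply: minL; last by move=> y [].
split; first exact: cnormalI.
- by move=> y Sy; split; [exact: Mker_maximal Sy|exact: SL].
- by move=> y [/NR].
- move=> NLV; apply: nLV => l Ll.
  have [v [Lv Vv] [n Nn e]] := RLVN _ (LR _ Ll).
  rewrite -e; apply: mem_mul => //; apply: NLV; split=> //.
  by apply: (mem_mulIl sL Lv); rewrite e.
Qed.

(** K lies in a proper open subgroup KO, and by compactness the union of a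
    chain of proper open subgroups is proper. *)
Lemma maximal_open_subgroup K : csubgroup K -> K <> setT ->
  exists M, [/\ open M, is_subgroup M, K `<=` M, M <> setT &
    forall L, is_subgroup L -> M `<=` L -> L <> setT -> L = M].
Proof.
move=> [cK sK] nK.
have [x nKx] : exists x, ~ K x.
  apply: contrapT => nx; apply: nK; apply/seteqP; split=> // x _.
  by apply: contrapT => nKx; apply: nx; exists x.
have [||O oO OK] := @onormal_basis X [set y | (~` K) (x * y)].
- by apply: shift_open; exact: closed_openC.
- by rewrite /= mulg1.
have [opO sO nO] := oO.
have sKO : is_subgroup (K *s O) by exact: prodset_subgroup.
have oKO L : K *s O `<=` L -> is_subgroup L -> open L.
  move=> KOL sL; apply: (open_overgroup opO) => //; first exact: mem_one.
  by apply: subset_trans KOL; exact: prodset_subr.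
have [||M [[sM KM nM] _ maxM]] :=
    @Zorn_above _ [set L : set X | [/\ is_subgroup L, K *s O `<=` L & L <> setT]] (K *s O).
- split=> // KO; have : (K *s O) x by rewrite KO.
  case=> k Kk [o Oo ko]; apply: (OK o^-1); first exact: mem_inv.
  by rewrite -ko mulgK.
- move=> F Fg [A FA] tF; split.
  + split; first by exists A => //; have [[]] := Fg _ FA.
    move=> y z [B FB By] [C FC Cz].
    have [BC|CB] := tF _ _ FB FC; [exists C|exists B] => //.
      by have [sC _ _] := Fg _ FC; apply: sC.2 => //; exact: BC.
    by have [sB _ _] := Fg _ FB; apply: sB.2 => //; exact: CB.
  + by move=> y KOy; exists A => //; have [_ h _] := Fg _ FA; exact: h.
  + move=> FT.
    have [||||B|_ [B FB <-] BE] := @chain_compact X (@compactG X) (setC @` F) set0.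
    * by move=> _ [B /Fg[sB KOB _] <-]; apply: open_closedC; exact: oKO.
    * by exists (~` A), A.
    * move=> _ _ [B FB <-] [C FC <-].
      by case: (tF _ _ FB FC) => /subsetC; [right|left].
    * exact: open0.
    * move=> h; have [C FC CB] : (\bigcup_(A in F) A) B by rewrite FT.
      by apply: (h (~` C)) => //; exists C.
    * have [_ _] := Fg _ FB; apply; apply/seteqP; split=> // y _.
      by apply: contrapT => /BE.
exists M; split=> //; first exact: oKO.
  by apply: subset_trans KM; exact: prodset_subl.
by move=> L sL ML nL; apply: maxM => //; split=> //; exact: subset_trans ML.
Qed.

(** A subgroup K violating compactness can be taken maximal open, and then
    S / (K & S) is a chief factor.  Let W = (K & N)S and let V be maximal
    among the normal subgroups above W meeting SN in W.  By the socle lemma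
    R lies in VSN: otherwise some L could be added to V.  The supplement K
    transports V to VK = (V & K)N, which meets S in K & S, while R = (R & VK)S.
    Hence R & VK is maximal below R without containing S, although S is
    contained in all the subgroups that are maximal below R. *)
Lemma fundament_compact N : onormal N -> compact_over S N.
Proof.
move=> oN K0 cK0 NSK0 K0S K0N; apply: contrapT => nK0.
have [K [oK sK K0K nK maxK]] := maximal_open_subgroup cK0 nK0.
have NSK : N `&` S `<=` K by exact: subset_trans K0K.
have KS : K *s S = setT by exact: prodset_fullS K0S.
have KN : K *s N = setT by exact: prodset_fullS K0N.
have cN := onormal_cnormal oN; have [opN sN nN] := oN.
have cS := Mker_cnormal; have [_ sS nS] := cS; have [_ sR nR] := cR.
have clK := open_subgroup_closed oK sK.
have nKS : is_normal (K `&` S) by exact: supplement_normal sK sS nS sN nN NSK KN.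
have nKN : is_normal (K `&` N).
  by apply: supplement_normal sK sN nN sS nS _ KS; rewrite setIC.
have nSK : ~ S `<=` K.
  move=> SK; apply: nK; apply/seteqP; split=> // x _.
  by have [k [s [Kk /SK Ks ->]]] := prodset_full x KS; exact: mem_mul.
(* For Y between K & S and S, either KY = K or KY = X as K is maximal. *)
have chief Y : cnormal Y -> K `&` S `<=` Y -> Y `<=` S -> Y `<=` K \/ S `<=` Y.
  move=> [_ sY nY] KSY YS.
  have [KY|nKY] := pselect (K *s Y = setT).
    right=> s Ss; have [k [y [Kk Yy e]]] := prodset_full s KY.
    rewrite e; apply: mem_mul => //; apply: KSY; split=> //.
    by apply: (mem_mulIr sS (YS _ Yy)); rewrite -e.
  left; rewrite -(maxK (K *s Y)) //; first exact: prodset_subr.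
    exact: prodset_subgroup.
  exact: prodset_subl.
pose W := (K `&` N) *s S.
have oW : onormal W.
  by apply: onormalM => //; split=> //; [exact: openI|exact: subgroupI].
have [opW sW nW] := oW.
have SW : S `<=` W by apply: prodset_subr; exact: subgroupI.
pose SN := S *s N.
have sSN : is_subgroup SN by exact: prodset_subgroup.
have [||V [[sV nV VSN] WV maxV]] := @Zorn_above _
    [set V : set X | [/\ is_subgroup V, is_normal V & V `&` SN `<=` W]] W.
- by split=> // x [].
- move=> F Fg [A FA] tF; split.
  + split; first by exists A => //; have [[]] := Fg _ FA.
    move=> y z [B FB By] [C FC Cz].
    have [BC|CB] := tF _ _ FB FC; [exists C|exists B] => //.
      by have [sC _ _] := Fg _ FC; apply: sC.2 => //; exact: BC.
    by have [sB _ _] := Fg _ FB; apply: sB.2 => //; exact: CB.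
  + by move=> y z [B FB By]; exists B => //; have [_ nB _] := Fg _ FB; exact: nB.
  + by move=> y [[B FB By] SNy]; have [_ _ h] := Fg _ FB; exact: h.
have oV : onormal V.
  by split=> //; apply: (open_overgroup opW) => //; exact: mem_one.
have SV : S `<=` V by exact: subset_trans WV.
have oU : onormal (V *s SN).
  by apply: onormalM => //; apply: cnormalM.
have RU : R `<=` V *s SN.
  apply: contrapT => nRU.
  have [|L [cL LR nLU LUS]] := socle oU _ nRU.
    by apply: subset_trans SV _; exact: prodset_subl.
  have [_ sL nL] := cL.
  apply: nLU; apply: (@subset_trans _ V); last exact: prodset_subl.
  rewrite -(maxV (V *s L)); [exact: prodset_subr| |exact: prodset_subl].
  split; [exact: prodset_subgroup|exact: prodset_normal|].
  move=> _ [[v Vv [l Ll <-]] vlSN].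
  have Vl : V l.
    apply: SV; apply: LUS; split=> //; exists v^-1; first exact: mem_inv.
    by exists (v * l); rewrite // mulKg.
  by apply: VSN; split=> //; exact: mem_mul.
(* K induces an isomorphism between the quotients of X by (K & N)S and by
   (K & S)N, under which V corresponds to VK. *)
pose VK := (V `&` K) *s N.
have sVIK : is_subgroup (V `&` K) by exact: subgroupI.
have oVK : onormal VK.
  have sVK : is_subgroup VK by exact: prodset_subgroup.
  split=> //.
    by apply: (open_overgroup opN) => //; [exact: mem_one|exact: prodset_subr].
  move=> _ y [v [Vv Kv] [n Nn <-]].
  have [k [m [Kk Nm ->]]] := prodset_full y KN.
  have Kvk : K (v ^ k) by rewrite /conjg; do 2?apply: mem_mul => //; exact: mem_inv.
  exists (v ^ k); first by split=> //; exact: nV.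
  exists (((v ^ k)^-1 * m^-1 * v ^ k) * (n ^ k * m)).
    apply: mem_mul => //; first by apply: mem_conjV => //; exact: mem_inv.
    by apply: mem_mul => //; exact: nN.
  by rewrite conjgM conjMg [_ ^ m]conjgE !mulgA mulgV mul1g.
have [_ sVK nVK] := oVK.
have VKS : VK `&` S `<=` K.
  move=> _ [[v [Vv Kv] [n Nn <-]] Ss].
  have [|n' [Kn' Nn'] [s' Ss' e]] := VSN v.
    split=> //; have -> : v = (v * n) * n^-1 by rewrite mulgK.
    by exists (v * n) => //; exists n^-1 => //; exact: mem_inv.
  have Ks' : K s' by apply: (mem_mulIl sK Kn'); rewrite e.
  have vn : v * n = n' * (s' * n * s'^-1) * s' by rewrite -e !mulgA mulgVK.
  rewrite vn; apply: mem_mul => //; apply: NSK; split.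
    by apply: mem_mul => //; exact: mem_conj.
  by apply: (mem_mulIr sS Ss'); rewrite -vn.
have nSVK : ~ S `<=` VK by move=> SVK; apply: nSK => s Ss; apply: VKS; split=> //; exact: SVK.
have RVS r : R r -> exists w s, [/\ (R `&` VK) w, S s & r = w * s].
  move=> Rr; have [v Vv [_ [s Ss [n Nn <-]] e]] := RU _ Rr.
  have [k [s1 [Kk Ss1 ev]]] := prodset_full v KS.
  have Ss2 := mem_mul sS Ss1 Ss.
  have er : r = (k * ((s1 * s) * n * (s1 * s)^-1)) * (s1 * s).
    by rewrite -e ev invgM !mulgA !mulgVK.
  exists (k * ((s1 * s) * n * (s1 * s)^-1)), (s1 * s); split=> //.
  split; first by apply: (mem_mulIr sR (Mker_sub Ss2)); rewrite -er.
  exists k; first by split=> //; apply: (mem_mulIr sV (SV _ Ss1)); rewrite -ev.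
  by exists ((s1 * s) * n * (s1 * s)^-1) => //; exact: mem_conj.
apply: (nSVK); apply: (@subset_trans _ (R `&` VK)); last by move=> x [].
apply: Mker_maximal; split.
- by apply: cnormalI => //; exact: onormal_cnormal.
- by move=> x [].
- by move=> RRV; apply: nSVK => s /Mker_sub/RRV[].
- move=> Y cY RVY YR; have [_ sY _] := cY.
  have [|||YSK|SY] := chief (Y `&` S).
  + exact: cnormalI.
  + move=> x [Kx Sx]; split=> //; apply: RVY; split; first exact: Mker_sub.
    by apply: prodset_subl => //; split=> //; exact: SV.
  + by move=> x [].
  + left=> y Yy; have [w [s [RVw Ss e]]] := RVS _ (YR _ Yy).
    have Ys : Y s by apply: (mem_mulIl sY (RVY _ RVw)); rewrite -e.
    rewrite e; apply: mem_mul => //; first exact: subgroupI.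
    split; first exact: Mker_sub.
    by apply: prodset_subl => //; split; [exact: SV|exact: YSK].
  + right=> r /RVS[w [s [RVw Ss ->]]]; apply: mem_mul => //; first exact: RVY.
    by have [] := SY _ Ss.
Qed.

End Fundament.

(** * Basic covers *)

Lemma comp_funE (A B C : Type) (f : B -> C) (g : A -> B) (h : A -> C) x :
  f \o g = h -> f (g x) = h x.
Proof. by move=> <-. Qed.

(** The embedding property of a cover E lifts E -> A to E -> B, the cartesian
    square combines this with the cover, and compactness gives surjectivity. *)
Lemma basic_I_cover (H G : profiniteGroupType) (tau : H -> G) :
  basic_cover tau -> I_cover tau.
Proof.
move=> [etau [B [A [beta [alpha [phi [[ebeta ealpha ephi]]]]]]]].
move=> [[fB [E0 [eps0 [[cE0 [_ I0]] [q0 eq0]]]]] [sq [bsub binj bsurj]] cpt].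
split=> // E eps cE; have [eeps eE] := cE.
have [psi0 epsi0 _] : dominates eps eps0 by exact: I0.
have qB : quotient_of E B by exists (q0 \o psi0); exact: epi_comp.
have qA : quotient_of E A by case: qB => q eq; exists (alpha \o q); exact: epi_comp.
have [gam egam gamE] : exists2 gam : E -> B, epimorphism gam & alpha \o gam = phi \o eps.
  apply: eE => //; last exact: epi_comp.
  by apply: quotient_finite fB _; exists alpha.
have hb := epi_hom ebeta; have ht := epi_hom etau.
have hg := epi_hom egam; have he := epi_hom eeps.
pose Gam := [set p : E * H | gam p.1 = beta p.2] `&` [set p | eps p.1 = tau p.2].
have clG : closed Gam.
  apply: closedI; apply: closed_eqfun => p.
  - by apply: continuous_comp; [exact: cvg_fst|exact: hg.2].
  - by apply: continuous_comp; [exact: cvg_snd|exact: hb.2].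
  - by apply: continuous_comp; [exact: cvg_fst|exact: he.2].
  - by apply: continuous_comp; [exact: cvg_snd|exact: ht.2].
have sG : is_subgroup Gam.
  split; first by split; rewrite /= ?(hom_one hg) ?(hom_one hb) ?(hom_one he) ?(hom_one ht).
  move=> [e x] [e' x'] [/= a b] [/= a' b']; split.
    by rewrite /= (hom_mul hg) (hom_mul hb) (hom_inv hg) (hom_inv hb) a a'.
  by rewrite /= (hom_mul he) (hom_mul ht) (hom_inv he) (hom_inv ht) b b'.
have tG e : exists x, Gam (e, x).
  have [|x _ [bx tx]] := bsurj (gam e, eps e); first exact: (comp_funE e gamE).
  by exists x; split; rewrite /= ?bx ?tx.
have KT : snd @` Gam = setT.
  apply: cpt; first exact: proj2_closed.
  - split; first by exists (1, 1) => //; exact: (mem_one sG).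
    move=> _ _ [[e x] Gx <-] [[e' x'] Gx' <-]; exists ((e, x) / (e', x')) => //.
    exact: sG.2.
  - apply/seteqP; split=> // b _; have [e <-] := epi_onto egam b.
    by have [x Gx] := tG e; exists x; [exists (e, x)|case: Gx => /= ->].
  - apply/seteqP; split=> // g _; have [e <-] := epi_onto eeps g.
    by have [x Gx] := tG e; exists x; [exists (e, x)|case: Gx => /= _ ->].
have cG : correspondence Gam.
  split=> // x; have : (snd @` Gam) x by rewrite KT.
  by case=> -[e y] Gy /= <-; exists e.
have [|h eh hE] := correspondence_epi cG (epi_id H).
  move=> x [/= bx tx]; apply: binj; rewrite ?in_setT//.
  by rewrite -bx -tx (hom_one hg) (hom_one hb) (hom_one he) (hom_one ht).
exists h => //; apply/funext => e /=; have [x Gx] := tG e.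
by rewrite (hE _ _ Gx); case: Gx.
Qed.

(** Subgroups that are maximal below ker tau pull back to subgroups that are
    maximal below ker rho. *)
Lemma Mker_map (X Y P : profiniteGroupType) (rho : X -> P) (tau : Y -> P) (psi : X -> Y) :
  epimorphism rho -> epimorphism tau -> epimorphism psi -> rho = tau \o psi ->
  Mker rho `<=` psi @^-1` Mker tau.
Proof.
move=> er et ep e x /(MkerP er)[Rx Nx]; apply/(MkerP et).
have hp := epi_hom ep.
have kE z : ker rho z <-> ker tau (psi z) by rewrite e.
split; first exact/kE.
move=> N [cN NR nRN maxN]; have : (psi @^-1` N) x; last by [].
apply: Nx; split.
- exact: preimage_cnormal.
- by move=> z /NR/kE.
- move=> RN; apply: nRN => y; have [z <-] := epi_onto ep y.
  by move=> /kE/RN.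
- move=> Z cZ NZ ZR.
  have [|||h|h] := maxN (psi @` Z).
  + exact: image_cnormal.
  + move=> y Ny; have [z zy] := epi_onto ep y; exists z => //.
    by apply: NZ; rewrite /preimage/= zy.
  + by move=> _ [z /ZR/kE Rz <-].
  + by left=> z Zz; apply: h; exists z.
  + right=> z /kE/h[w Zw wz]; have [_ sZ _] := cZ; have [_ sN _] := cN.
    have -> : z = w * (w^-1 * z) by rewrite mulgA mulgV mul1g.
    apply: mem_mul => //; apply: NZ.
    by rewrite /preimage/= (hom_mul hp) (hom_inv hp) wz mulVg; exact: mem_one.
Qed.

(** By minimality X is a quotient, over G, of the atomic cover Q found inside X
    itself.  Composing gives an endomorphism chi of X over G which carries the
    compact squares of Q to compact squares of X. *)
Lemma smallest_atomic (X G : profiniteGroupType) (pi : X -> G) :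
  smallest_embedding_cover pi -> atomic (ker pi) [set 1].
Proof.
move=> [[epi eX] [_ Ipi]].
have [Q [p [eps [ep epsp [cQ _] aQ]]]] := smallest_cover_exists epi eX.
have [psi epsi epsE] : dominates eps pi by exact: Ipi.
have echi : epimorphism (psi \o p) := epi_comp ep epsi.
have hchi := epi_hom echi; set chi := psi \o p in echi hchi.
have chiE x : pi (chi x) = pi x by rewrite -{2}epsp epsE.
have chiR x : ker pi (chi x) <-> ker pi x by rewrite /ker/= chiE.
have [_ sR nR] := ker_cnormal (epi_hom epi).
move=> N oN _; have [_ sN nN] := oN.
have oN' : onormal (chi @^-1` N) by exact: preimage_onormal.
have pN' : ker p `<=` chi @^-1` N.
  by move=> x px; rewrite /preimage/= /chi/= px (hom_one (epi_hom epsi)); exact: mem_one.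
have [M [oM MN MR cM]] := isolated_above (ker_cnormal (epi_hom epi)) oN' (aQ _ oN' pN').
have [_ sM nM] := oM.
have kM x : chi x = 1 -> M x.
  move=> cx; suff : (M `&` ker pi) x by case.
  rewrite MR; split; first by rewrite /preimage/= cx; exact: mem_one.
  by apply/chiR; rewrite cx; exact: (mem_one sR).
exists (chi @` M); split; first exact: image_onormal.
  by move=> _ [x /MN Nx <-].
move=> K [clK sK] MK KR KM.
have full (A : set X) (B : set X) : chi @` A = B -> K *s B = setT ->
    (forall x, chi x = 1 -> A x) -> is_subgroup A -> (chi @^-1` K) *s A = setT.
  move=> AB KB kA sA; apply/seteqP; split=> // x _.
  have [k [b [Kk]]] := prodset_full (chi x) KB; rewrite -AB => -[a Aa <-] e.
  exists (x * a^-1); last by exists a => //; rewrite mulgVK.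
  by rewrite /preimage/= (hom_mul hchi) (hom_inv hchi) e mulgK.
have KT : chi @^-1` K = setT.
  apply: cM.
  - by split; [exact: hom_preimage_closed|exact: hom_preimage_subgroup].
  - move=> x [Mx Rx]; apply: MK; split; first by exists x.
    exact/chiR.
  - apply: (full (ker pi) (ker pi)) => //; last first.
      by move=> x cx; apply/chiR; rewrite cx; exact: (mem_one sR).
    apply/seteqP; split=> [_ [x /chiR Rx <-]//|y Ry].
    by have [x xy] := epi_onto echi y; exists x => //; apply/chiR; rewrite xy.
  - exact: full KM _ _.
apply/seteqP; split=> // y _; have [x <-] := epi_onto echi y.
by have : (chi @^-1` K) x by rewrite KT.
Qed.

(** The smallest embedding cover Q -> P found inside X is an embedding cover of
    G as well, so it dominates X -> G; thus X and Q have the same finite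
    quotients. *)
Lemma smallest_quotient_Ef (X P G : profiniteGroupType) (pi : X -> G) (rho : X -> P)
    (f : P -> G) (B : profiniteGroupType) :
  smallest_embedding_cover pi -> epimorphism rho -> epimorphism f -> f \o rho = pi ->
  finite_set [set: B] -> quotient_of X B -> Ef P B.
Proof.
move=> [[epi eX] [_ Ipi]] er ef fr fB [q eq]; split=> //.
have [Q [p [eps [ep epsp sQ _]]]] := smallest_cover_exists er eX.
exists Q, eps; split=> //.
have [[eeps eQ] _] := sQ.
have [psi epsi _] : dominates (f \o eps) pi.
  by apply: Ipi; split=> //; exact: epi_comp.
by exists (q \o psi); exact: epi_comp.
Qed.

(** As ker tau is finite, some open V in H meets it trivially.  Any N whose
    trace on ker rho is that of the preimage of V then makes H the fibre
    product of X / N and P, and atomicity provides such an N with a compact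
    square. *)
Lemma atomic_basic (X P H : profiniteGroupType) (rho : X -> P) (tau : H -> P) :
  epimorphism rho -> atomic (ker rho) [set 1] ->
  (forall B : profiniteGroupType, finite_set [set: B] -> quotient_of X B -> Ef P B) ->
  epimorphism tau -> finite_set (ker tau) -> dominates rho tau -> basic_cover tau.
Proof.
move=> er aR EfX et fin [psi epsi rhoE].
have hp := epi_hom epsi; have hr := epi_hom er; have ht := epi_hom et.
have rhoE' x : rho x = tau (psi x) by rewrite rhoE.
have cR := ker_cnormal hr; have [_ sR nR] := cR.
have [||V oV VT] := @onormal_basis H (~` (ker tau `\ 1)).
- apply: closed_openC.
  apply: (accessible_finite_set_closed.1 (hausdorff_accessible (@profinite_hausdorff H))).
  by apply: sub_finite_set fin => x [].
- by move=> [_]; apply.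
have oN0 : onormal (psi @^-1` V) by exact: preimage_onormal.
have [|N [oN NN0 NR cN]] := isolated_above cR oN0 (aR _ oN0 _).
  by move=> _ ->; rewrite /preimage/= (hom_one hp); case: oV => _ /mem_one.
have [opN sN nN] := oN; have cnN := onormal_cnormal oN.
have kN x : (N `&` ker rho) x <-> psi x = 1.
  rewrite NR; split=> [[/VT Vx Rx]|px].
    apply: contrapT => npx; apply: Vx; split=> //.
    by rewrite /ker/= -rhoE'.
  split; first by rewrite /preimage/= px; case: oV => _ /mem_one.
  by rewrite /ker/= rhoE' px (hom_one ht).
have [B [b [eb kb]]] := quotient_epi cnN; have hb := epi_hom eb.
have [A [a [ea ka]]] := quotient_epi (cnormalM cnN cR); have ha := epi_hom ea.
have [|beta ebeta betaE] := factor_epi epsi eb.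
  by rewrite kb => x /kN[].
have [|alpha ealpha alphaE] := factor_epi eb ea.
  by rewrite kb ka; exact: prodset_subl.
have [|phi ephi phiE] := factor_epi er ea.
  by rewrite ka; exact: prodset_subr.
split=> //; exists B, A, beta, alpha, phi; split=> //; split.
- apply: EfX; last by exists b.
  by apply/(open_ker_finite eb); rewrite kb.
- split.
    apply/funext => h /=; have [x <-] := epi_onto epsi h.
    by rewrite betaE alphaE -rhoE' phiE.
  split.
  + move=> h _ /=; have [x <-] := epi_onto epsi h.
    by rewrite betaE alphaE -rhoE' phiE.
  + move=> h h' _ _ [bh th]; have [x xh] := epi_onto epsi h; have [x' xh'] := epi_onto epsi h'.
    rewrite -xh -xh'; apply/(ker_eq hp); apply/kN; split.
      by rewrite -kb; apply/(ker_eq hb); rewrite -!betaE xh xh'.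
    by apply/(ker_eq hr); rewrite !rhoE' xh xh'.
  + move=> [y z] /= yz; have [x xy] := epi_onto eb y; have [x' xz] := epi_onto er z.
    have : ker a (x^-1 * x') by apply/(ker_eq ha); rewrite -alphaE xy -phiE xz.
    rewrite ka => -[n Nn [r Rr e]].
    exists (psi (x * n)) => //; congr pair.
      rewrite betaE (hom_mul hb) xy [b n](_ : _ = 1) ?mulg1//.
      by have : ker b n by rewrite kb.
    rewrite -rhoE' -xz; apply/(ker_eq hr).
    suff -> : (x * n)^-1 * x' = r by [].
    by rewrite invgM -mulgA -e mulgA mulVg mul1g.
- move=> K clK sK KB KG.
  have KT : psi @^-1` K = setT.
    apply: cN.
    + by split; [exact: hom_preimage_closed|exact: hom_preimage_subgroup].
    + by move=> x /kN px; rewrite /preimage/= px; exact: mem_one.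
    + apply: prodset_fullP => x.
      have [h Kh hx] : (tau @` K) (rho x) by rewrite KG.
      have [y yh] := epi_onto epsi h; exists y; split; first by rewrite /preimage/= yh.
      by apply/(ker_eq hr); rewrite rhoE' yh hx.
    + apply: prodset_fullP => x.
      have [h Kh hx] : (beta @` K) (b x) by rewrite KB.
      have [y yh] := epi_onto epsi h; exists y; split; first by rewrite /preimage/= yh.
      by rewrite -kb; apply/(ker_eq hb); rewrite -betaE yh hx.
  apply/seteqP; split=> // h _; have [x <-] := epi_onto epsi h.
  by have : (psi @^-1` K) x by rewrite KT.
Qed.

(** * The fundament series *)

Section Series.
Variables (H : profiniteGroupType) (G_ : nat -> profiniteGroupType) (pi : H -> G_ 0).
Variables (pi_ : forall k, G_ k.+1 -> G_ k) (rho_ : forall k, H -> G_ k).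
Hypotheses (hpi : smallest_embedding_cover pi) (hseries : fundament_series pi pi_ rho_).

Lemma series_epi k : epimorphism (rho_ k).
Proof.
have [rho0 fund] := hseries; case: k => [|k]; last by case: (fund k).
by rewrite rho0; case: hpi => -[].
Qed.

Lemma series_base k : exists2 f : G_ k -> G_ 0, epimorphism f & f \o rho_ k = pi.
Proof.
have [rho0 fund] := hseries; elim: k => [|k [f ef fE]].
  by exists id => //; exact: epi_id.
have [_ _ epk pkE] := fund k; exists (f \o @pi_ k); first exact: epi_comp.
by rewrite -fE -pkE.
Qed.

(** At the base this is the minimality of pi; above it, the fundament makes
    every square compact. *)
Lemma series_atomic k : atomic (ker (rho_ k)) [set 1].
Proof.
have [rho0 fund] := hseries; case: k => [|k]; first by rewrite rho0; exact: smallest_atomic.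
have [_ kq _ _] := fund k; move=> N oN _; exists N; split=> //.
by rewrite kq; exact: fundament_compact (series_epi k) _ oN.
Qed.

End Series.

Theorem corollary4p5 (H : profiniteGroupType)
    (G_ : nat -> profiniteGroupType) (pi : H -> G_ 0)
    (pi_ : forall k, G_ k.+1 -> G_ k) (rho_ : forall k, H -> G_ k)
    (hpi : smallest_embedding_cover pi)
    (hseries : fundament_series pi pi_ rho_)
    (k : nat) (k_gt0 : 0 < k)
    (H' : profiniteGroupType) (tau : H' -> G_ k.-1)
    (htau : fundamental tau) (tau_fin : finite_set (ker tau)) :
  [<-> basic_cover tau;
       I_cover tau;
       dominates (rho_ k.-1) tau;
       dominates (pi_ k.-1) tau].
Proof.
move: k.-1 H' tau htau tau_fin => {k_gt0} {}k H' tau [etau Mtau] fin.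
have er := series_epi hpi hseries k.
have [_ fund] := hseries; have [eq kq _ piE] := fund k.
tfae.
- exact: basic_I_cover.
- by move=> [_]; apply; split=> //; case: hpi => -[].
- move=> [psi epsi rhoE].
  have [|h eh hE] := factor_epi eq epsi.
    rewrite kq => x /(Mker_map er etau epsi rhoE).
    by rewrite Mtau.
  exists h => //; apply/funext => y; have [x <-] := epi_onto eq y.
  by rewrite /= hE (comp_funE x piE) rhoE.
- move=> [psi epsi piE'].
  have [f ef fE] := series_base hseries k.
  apply: (atomic_basic er (series_atomic hpi hseries k)) => //.
    by move=> B fB qB; exact: smallest_quotient_Ef hpi er ef fE fB qB.
  by exists (psi \o rho_ k.+1); [exact: epi_comp|rewrite -piE piE'].
Qed.
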